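(* There is an absolute constant $c>0$ (independent of the dimension of $\mathcal X$) such that the following holds. Take any $h\in\mathbb R^d$. Let $R$ be a $k\times d$ random matrix, $k\le d$, with i.i.d. zero-mean Gaussian entries. For all $\delta\in(0,1)$, the compressive ERM classifier $(\hat h_R,b)$ satisfies, with probability $1-2\delta$, $$\Pr_{x,y}\{(\hat h_R^TRx+b)y\le 0\}\le\frac1N\sum_{n=1}^N f_k(\theta^h_{x_ny_n})+c\sqrt{\frac{k+1+\log\frac1\delta}{N}}+\min\left\{\frac{1-\delta}{\delta}\cdot\frac1N\sum_{n=1}^N f_k(\theta^h_{x_ny_n}),\ \sqrt{\tfrac12\log\tfrac1\delta}\right\},$$ and likewise (with probability $1-2\delta$) $$\Pr_{x,y}\{(\hat h_R^TRx+b)y\le 0\}\le\mathrm E_{x,y}[f_k(\theta^{h^*}_{xy})]+2c\sqrt{\frac{k+1+\log\frac1\delta}{N}}+\min\left\{\frac{1-\delta}{\delta}\cdot\mathrm E_{x,y}[f_k(\theta^{h^*}_{xy})],\ \sqrt{\tfrac12\log\tfrac1\delta}\right\}.$$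
   Context: Setting: $\mathcal X\subseteq\mathbb R^d$, $\mathcal D$ is an unknown distribution on $\mathcal X\times\{-1,1\}$, and $\mathcal T^N=\{(x_n,y_n)\}_{n=1}^N$ is a training set drawn i.i.d. from $\mathcal D$. The matrix $R\in\mathbb R^{k\times d}$ has i.i.d. $\mathcal N(0,\sigma^2)$ entries and is drawn independently of the data. Compressive ERM classifier: given $R$ and $\mathcal T^N$, $(\hat h_R,b)\in\mathbb R^k\times\mathbb R$ is a minimizer of the empirical zero-one error $\frac1N\sum_{n=1}^N\mathbf 1((h_R^TRx_n+b)y_n\le 0)$ over all $(h_R,b)\in\mathbb R^k\times\mathbb R$. $h^*\in\mathbb R^d$ denotes the optimal homogeneous linear classifier, i.e. a minimizer over $h\in\mathbb R^d$ of $\Pr_{x,y}[h^Txy\le 0]$. For (nonzero) $u,h\in\mathbb R^d$, $\theta_u^h$ is the angle between them. The flipping probability is $f_k(\theta_u^h):=\Pr_R\{h^TR^TRu\le 0\}$, which for Gaussian $R$ depends only on $k$ and the angle: $f_k(\theta)=\frac{\Gamma(k)}{(\Gamma(k/2))^2}\int_0^{\frac{1-\cos\theta}{1+\cos\theta}}\frac{z^{(k-2)/2}}{(1+z)^k}\,dz$. $\Pr_{x,y}$ and $\mathrm E_{x,y}$ are with respect to a fresh $(x,y)\sim\mathcal D$, conditionally on $\mathcal T^N$ and $R$; ''with probability $1-2\delta$'' is with respect to the draws of $\mathcal T^N$ and $R$. *)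

(* Defs.v *)
From HB Require Import structures.
From mathcomp Require Import all_boot all_order all_algebra.
From mathcomp Require Import all_classical all_reals all_analysis.

Set Implicit Arguments.
Unset Strict Implicit.
Unset Printing Implicit Defensive.

Import Order.TTheory GRing.Theory Num.Theory.
Import numFieldNormedType.Exports.

Local Open Scope classical_set_scope.
Local Open Scope ring_scope.

(* Matrices carry the sigma-algebra generated by their entries (over the reals,
   the Borel one); vectors of R^d are column matrices 'cV[R]_d. *)
Definition measure_matrix_display : measure_display -> measure_display.
Proof. exact. Qed.

Section measurable_matrix.
Context {disp : measure_display} {T : measurableType disp}.
Variables m n : nat.

Definition g_sigma_entries : set (set 'M[T]_(m, n)) :=
  <<s \bigcup_(ij in [set: 'I_m * 'I_n])
        preimage_set_system setT (fun M : 'M[T]_(m, n) => M ij.1 ij.2)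
          measurable >>.

Let entries_set0 : g_sigma_entries set0.
Proof. exact: sigma_algebra0. Qed.

Let entries_setC A : g_sigma_entries A -> g_sigma_entries (~` A).
Proof. exact: sigma_algebraC. Qed.

Let entries_bigcup (F : (set 'M[T]_(m, n))^nat) :
  (forall i, g_sigma_entries (F i)) -> g_sigma_entries (\bigcup_i F i).
Proof. exact: sigma_algebra_bigcup. Qed.

HB.instance Definition _ := @isMeasurable.Build (measure_matrix_display disp)
  'M[T]_(m, n) g_sigma_entries entries_set0 entries_setC entries_bigcup.

End measurable_matrix.

Section independence.
Context {d : measure_display} {Omega : measurableType d} {R : realType}.
Variable P : probability Omega R.

Definition mutually_independent {d' : measure_display} {T : measurableType d'}
    {I : finType} (X : I -> Omega -> T) : Prop :=
  forall (J : {set I}) (B : I -> set T), (forall i, measurable (B i)) ->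
    P (\bigcap_(i in [set` J]) (X i @^-1` B i)) =
    (\prod_(i in J) P (X i @^-1` B i))%E.

Definition independent2 {d1 d2 : measure_display} {T1 : measurableType d1}
    {T2 : measurableType d2} (X : Omega -> T1) (Y : Omega -> T2) : Prop :=
  forall (A : set T1) (B : set T2), measurable A -> measurable B ->
    P (X @^-1` A `&` Y @^-1` B) = (P (X @^-1` A) * P (Y @^-1` B))%E.

Definition has_law {d' : measure_display} {T : measurableType d'}
    (X : Omega -> T) (mu : set T -> \bar R) : Prop :=
  forall B : set T, measurable B -> P (X @^-1` B) = mu B.

(* The event E need not be measurable (an arbitrary choice of empirical
   minimizers is not), hence the inner probability. *)
Definition with_probability_at_least (p : R) (E : set Omega) : Prop :=
  exists A : set Omega, [/\ measurable A, A `<=` E & (p%:E <= P A)%E].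

End independence.

Section compressive_classification.
Context {R : realType}.


Definition dotv (n : nat) (u v : 'cV[R]_n) : R := (u^T *m v) 0 0.

Definition iid_sample {dO : measure_display} {Omega : measurableType dO}
    (P : probability Omega R) (d N : nat)
    (D : probability ('cV[R]_d * R)%type R)
    (S : 'I_N -> {RV P >-> ('cV[R]_d * R)%type}) : Prop :=
  mutually_independent P (fun n => S n : Omega -> 'cV[R]_d * R) /\
  forall n, has_law P (S n) D.

Definition gaussian_matrix {dO : measure_display} {Omega : measurableType dO}
    (P : probability Omega R) (k d : nat) (sigma : R)
    (M : {RV P >-> 'M[R]_(k, d)}) : Prop :=
  mutually_independent P (fun (ij : 'I_k * 'I_d) w => M w ij.1 ij.2) /\
  forall i j, has_law P (fun w => M w i j) (normal_prob 0 sigma).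

(* Whole training set as a single random element, for joint independence. *)
Definition training_set {dO : measure_display} {Omega : measurableType dO}
    (P : probability Omega R) (d N : nat)
    (S : 'I_N -> {RV P >-> ('cV[R]_d * R)%type}) (w : Omega) :
    N.-tuple ('cV[R]_d * R)%type :=
  [tuple S n w | n < N].

(* Pr_R {h^T R^T R u <= 0}: this is f_k at the angle between h and u when both
   are nonzero, and equals 1 when h or u is 0. *)
Definition flip_prob {dO : measure_display} {Omega : measurableType dO}
    (P : probability Omega R) (k d : nat) (M : {RV P >-> 'M[R]_(k, d)})
    (h u : 'cV[R]_d) : R :=
  fine (P [set w | (h^T *m (M w)^T *m M w *m u) 0 0 <= 0]).

Definition true_error (d : nat) (D : probability ('cV[R]_d * R)%type R)
    (g : 'cV[R]_d -> R) : R :=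
  fine (D [set z | g z.1 * z.2 <= 0]).

Definition empirical_error (d N : nat) (s : 'I_N -> 'cV[R]_d * R)
    (g : 'cV[R]_d -> R) : R :=
  N%:R^-1 * \sum_(n < N) (g (s n).1 * (s n).2 <= 0)%R%:R.

Definition compressive_classifier (k d : nat) (M : 'M[R]_(k, d))
    (a : 'cV[R]_k) (b : R) : 'cV[R]_d -> R :=
  fun x => dotv a (M *m x) + b.

Definition is_compressive_ERM (k d N : nat) (M : 'M[R]_(k, d))
    (s : 'I_N -> 'cV[R]_d * R) (a : 'cV[R]_k) (b : R) : Prop :=
  forall (a' : 'cV[R]_k) (b' : R),
    empirical_error s (compressive_classifier M a b) <=
    empirical_error s (compressive_classifier M a' b').

Definition is_optimal_homogeneous (d : nat)
    (D : probability ('cV[R]_d * R)%type R) (h : 'cV[R]_d) : Prop :=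
  forall h' : 'cV[R]_d, true_error D (dotv h) <= true_error D (dotv h').

Definition empirical_flip {dO : measure_display} {Omega : measurableType dO}
    (P : probability Omega R) (k d N : nat) (M : {RV P >-> 'M[R]_(k, d)})
    (h : 'cV[R]_d) (s : 'I_N -> 'cV[R]_d * R) : R :=
  N%:R^-1 * \sum_(n < N) flip_prob M h ((s n).2 *: (s n).1).

Definition expected_flip {dO : measure_display} {Omega : measurableType dO}
    (P : probability Omega R) (k d : nat) (M : {RV P >-> 'M[R]_(k, d)})
    (D : probability ('cV[R]_d * R)%type R) (h : 'cV[R]_d) : R :=
  fine ('E_D[fun z : 'cV[R]_d * R => flip_prob M h (z.2 *: z.1)]).

End compressive_classification.

(* Main.v *)
(* The empirical risk minimizer competes with the projected classifier R h, so
   the theorem needs two events, each failing with probability at most delta.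

   (i) Uniform deviation of the zero-one error over affine halfspaces of R^k at
   rate sqrt((k + 1 + log (1/delta)) / N), conditionally on R.  To have no
   logarithm of N, the Rademacher process of a class of VC dimension K is
   chained over scales 4^-j: a family separated at scale 4^-j has at most
   exp(5 (j+1) K) members (Sauer-Shelah applied to a separating random sample).
   A countable class of enlarged rational halfspaces suffices, and for its finite
   subfamilies the data may be replaced by finitely many cells, so that
   symmetrization by a ghost sample takes place among finite sums.

   (ii) The error of the classifier R h exceeds its mean over R, an average of
   flipping probabilities, by at most the minimum in the statement.  Markov's
   inequality gives both terms.  *)

From HB Require Import structures.
Require Import Defs.
From mathcomp Require Import all_boot all_order all_algebra.
From mathcomp Require Import all_classical all_reals all_analysis.
From mathcomp Require Import measurable_realfun.
From mathcomp Require Import lra ring.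

Set Implicit Arguments.
Unset Strict Implicit.
Unset Printing Implicit Defensive.

Import Order.TTheory GRing.Theory Num.Theory.
Import numFieldNormedType.Exports.

Local Open Scope ring_scope.

(** * Sauer-Shelah, packing and chaining *)

Section shattering.
Variable I : finType.
Implicit Types (A : {set {set I}}) (T B a : {set I}).

Definition shatters A T := [forall B in powerset T, [exists a in A, a :&: T == B]].

Lemma shattersP A T :
  reflect (forall B, B \subset T -> exists2 a, a \in A & a :&: T = B)
          (shatters A T).
Proof.
apply: (iffP forall_inP) => [h B BT|h B]; last rewrite powersetE => /h.
- by have /h/exists_inP[a aA /eqP e] : B \in powerset T; [rewrite powersetE|exists a].
- by case=> a aA e; apply/exists_inP; exists a => //; apply/eqP.
Qed.

(* Pajor's strengthening of the Sauer-Shelah lemma: splitting A along an element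
   x that distinguishes two of its members, a set shattered by both halves
   counts twice, for itself and for its union with x. *)
Lemma card_le_shattered A : (#|A| <= #|[set T | shatters A T]|)%N.
Proof.
move: {2}#|A|.+1 (ltnSn #|A|) => n; elim: n A => // n IH A; rewrite ltnS => An.
have [A1|A1] := leqP #|A| 1.
  case: (posnP #|A|) => [->//|A0].
  apply: (leq_trans A1); rewrite card_gt0; apply/set0Pn; exists finset.set0.
  rewrite inE; apply/shattersP => B; rewrite finset.subset0 => /eqP ->.
  case/card_gt0P: A0 => a aA; exists a => //; exact: finset.setI0.
case/card_gt1P: A1 => a [b [aA bA ab]].
have [x xab] : exists x, (x \in a) != (x \in b).
  apply/existsP; apply: contraNT ab => /existsPn h; apply/eqP/setP => x.
  by apply/eqP; have := h x; rewrite negbK.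
wlog [xa xb] : a b aA bA ab xab / x \in a /\ x \notin b.
  move=> W; case xa: (x \in a); case xb: (x \in b); rewrite xa xb // in xab.
    by apply: (W a b) => //; rewrite xa xb.
  by apply: (W b a) => //; rewrite ?xa ?xb // eq_sym.
pose A1 := [set c in A | x \in c]; pose A0 := [set c in A | x \notin c].
have cA : #|A| = (#|A1| + #|A0|)%N.
  rewrite -[LHS](cardsID [set c : {set I} | x \in c] A); congr (_ + _)%N.
    by apply: eq_card => c; rewrite !inE.
  by apply: eq_card => c; rewrite !inE andbC.
have p1 : (0 < #|A1|)%N by apply/card_gt0P; exists a; rewrite !inE aA xa.
have p0 : (0 < #|A0|)%N by apply/card_gt0P; exists b; rewrite !inE bA xb.
have sub A' T : A' \subset A -> shatters A' T -> shatters A T.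
  move=> /fintype.subsetP s /shattersP h; apply/shattersP => B /h[c /s]; by exists c.
have s1 : A1 \subset A by apply/fintype.subsetP => c; rewrite inE => /andP[].
have s0 : A0 \subset A by apply/fintype.subsetP => c; rewrite inE => /andP[].
have nx A' T : A' = A1 \/ A' = A0 -> shatters A' T -> x \notin T.
  move=> A'E /shattersP h; apply/negP => xT.
  case: A'E => ->{A'} in h.
    have [|c] := h (T :\ x); first by rewrite subD1set.
    by rewrite inE => /andP[cA' xc] /setP/(_ x); rewrite !inE xc xT eqxx.
  have [|c] := h T; first by [].
  by rewrite inE => /andP[cA' xc] /setP/(_ x); rewrite !inE (negbTE xc) xT.
pose S1 := [set T | shatters A1 T]; pose S0 := [set T | shatters A0 T].
pose f T := x |: T.
have fi : {in S1 :&: S0 &, injective f}.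
  move=> T U; rewrite !inE => /andP[T1 _] /andP[U1 _] /setP fTU; apply/setP => y.
  have := fTU y; rewrite !inE; case: (eqVneq y x) => //= -> _.
  by rewrite (negbTE (nx _ _ (or_introl erefl) T1)) (negbTE (nx _ _ (or_introl erefl) U1)).
have dis : [disjoint S1 :|: S0 & f @: (S1 :&: S0)].
  rewrite -setI_eq0; apply/eqP/setP => T; rewrite !inE; apply/negP => /andP[h /imsetP[U _ TU]].
  have : x \in T by rewrite TU !inE eqxx.
  apply/negP; case/orP: h => h; [exact: nx (or_introl erefl) h|exact: nx (or_intror erefl) h].
have [l1 l0] : (#|A1| < n)%N /\ (#|A0| < n)%N.
  rewrite cA in An; split; apply: leq_trans An; first by rewrite -addn1 leq_add2l.
  by rewrite -add1n leq_add2r.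
rewrite cA (leq_trans (leq_add (IH A1 l1) (IH A0 l0)))//.
rewrite -/S1 -/S0 -cardsUI -(card_in_imset fi).
have -> : (#|S1 :|: S0| + #|f @: (S1 :&: S0)| = #|(S1 :|: S0) :|: f @: (S1 :&: S0)|)%N.
  by rewrite [RHS]cardsU [X in (_ - #|pred_of_set X|)%N](disjoint_setI0 dis) cards0 subn0.
apply/subset_leq_card/fintype.subsetP => T; rewrite !inE => /orP[/orP[]|]; [exact: sub|exact: sub|].
move=> /imsetP[U]; rewrite !inE => /andP[/[dup] U1 /shattersP h1 /shattersP h0 ->{T}].
have xU := nx _ _ (or_introl erefl) U1.
apply/shattersP => B BU.
have BxU : B :\ x \subset U by rewrite subDset.
case xB : (x \in B).
  have [c] := h1 _ BxU; rewrite inE => /andP[cA' xc] cU; exists c => //.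
  rewrite /f finset.setIUr cU; apply/setP => y; rewrite !inE.
  by case: eqVneq => [->|_]; rewrite ?xc ?xB // andbF.
have [c] := h0 _ BxU; rewrite inE => /andP[cA' xc] cU; exists c => //.
rewrite /f finset.setIUr cU; apply/setP => y; rewrite !inE.
by case: eqVneq => [->|_]; rewrite ?(negbTE xc) ?xB // andbF.
Qed.

(** Weigh each set [T] by [x ^+ #|T|]: together the subsets of [I] weigh [(1 + x) ^+ #|I|], while
    each shattered one weighs at least [x ^+ D] because [x <= 1]. Keeping [x] free avoids binomial
    sums. *)
Lemma sauer_shelah (R : realFieldType) A (D : nat) (x : R) : 0 < x <= 1 ->
  (forall T, shatters A T -> (#|T| <= D)%N) ->
  x ^+ D * #|A|%:R <= (1 + x) ^+ #|I|.
Proof.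
move=> /andP[x0 x1] AD.
have -> : (1 + x) ^+ #|I| = \sum_(T : {set I}) x ^+ #|T|.
  rewrite -prodr_const (eq_bigr (fun=> x + 1)); last by move=> *; rewrite addrC.
  rewrite bigA_distr; apply: eq_bigr => T _.
  by rewrite -big_mkcond/= prodr_const.
apply: (@le_trans _ _ (x ^+ D * #|[set T | shatters A T]|%:R)).
  by apply: ler_wpM2l; [exact/exprn_ge0/ltW|rewrite ler_nat card_le_shattered].
rewrite -sum1_card natr_sum mulr_sumr [leRHS](bigID (mem [set T | shatters A T]))/=.
rewrite -[leLHS]addr0 lerD ?sumr_ge0//; last by move=> *; rewrite exprn_ge0 ?ltW.
by apply: ler_sum => T; rewrite inE mulr1 => /AD ?; rewrite ler_wiXn2l// ltW.
Qed.

End shattering.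

(** * Exponential moments and tails of Rademacher sums *)

Section subgaussian.
Variable R : realType.

(** The linear term vanishes on averaging a centered variable, which leaves a sub-Gaussian factor.
    For [x <= 1/2] it follows from [expR x <= 1 / (1 - x)]; beyond that [2 * x ^+ 2] already exceeds
    [x]. *)
Lemma expR_le_subgaussian (x : R) : expR x <= x + expR (2 * x ^+ 2).
Proof.
have [x2|x2] := leP x (1/2); last first.
  apply: (@le_trans _ _ (expR (2 * x ^+ 2))); last by rewrite lerDr; lra.
  by rewrite ler_expR; nra.
apply: (@le_trans _ _ (x + (1 + 2 * x ^+ 2))); last by rewrite lerD2l expR_ge1Dx.
have h : 1 - x <= expR (- x) by exact: (expR_ge1Dx (- x)).
have e : expR x * expR (- x) = 1 by rewrite -expRD subrr expR0.
have p := expR_gt0 x.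
have h2 : 1 <= (1 - x) * (x + (1 + 2 * x ^+ 2)) by nra.
have h3 : expR x * (1 - x) <= 1 by rewrite -[X in _ <= X]e ler_pM2l.
have x1 : 0 < 1 - x by lra.
by rewrite -(ler_pM2r x1) (le_trans h3)// mulrC.
Qed.

(** Chernoff's method: the exponential moment, summed over all sign vectors, factors over the
    coordinates. *)
Lemma rademacher_tail1 (I : finType) (c : I -> R) (v u : R) : 0 < v -> 0 <= u ->
  \sum_i c i ^+ 2 <= v ->
  #|[set s : {ffun I -> bool} | u < \sum_i (-1) ^+ s i * c i]|%:R
    <= 2 ^+ #|I| * expR (- (u ^+ 2 / (8 * v))).
Proof.
move=> v0 u0 cv; set E := [set _ | _].
(* This [l] minimizes the exponent [2 * l ^+ 2 * v - l * u], with minimum [- u ^+ 2 / (8 * v)]. *)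
pose l := u / (4 * v).
have l0 : 0 <= l by rewrite divr_ge0// mulr_ge0// ltW.
have h1 : #|E|%:R * expR (l * u) <=
    \sum_(s : {ffun I -> bool}) \prod_i expR (l * ((-1) ^+ s i * c i)).
  rewrite -sum1_card natr_sum mulr_suml [leRHS](bigID (mem E))/= -[leLHS]addr0.
  apply: lerD; last by apply: sumr_ge0 => s _; apply: prodr_ge0 => i _; exact: expR_ge0.
  apply: ler_sum => s; rewrite inE => /ltW us.
  by rewrite mul1r -expR_sum -mulr_sumr ler_expR ler_wpM2l.
rewrite -(bigA_distr_bigA (fun i (b : bool) => expR (l * ((-1) ^+ b * c i)))) in h1.
have h2 : \prod_i \sum_(b : bool) expR (l * ((-1) ^+ b * c i)) <=
    2 ^+ #|I| * expR (2 * l ^+ 2 * v).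
  apply: (@le_trans _ _ (\prod_i (2 * expR (2 * (l * c i) ^+ 2)))).
    apply: ler_prod => i _; apply/andP; split.
      by apply: sumr_ge0 => *; exact: expR_ge0.
    rewrite big_bool/= expr1 expr0 mul1r mulN1r mulrN.
    have := expR_le_subgaussian (l * c i).
    have := expR_le_subgaussian (- (l * c i)); rewrite sqrrN; lra.
  rewrite big_split/= prodr_const -expR_sum ler_pM2l ?exprn_gt0// ler_expR.
  under eq_bigr do rewrite exprMn mulrA.
  by rewrite -mulr_sumr ler_wpM2l// mulr_ge0// sqr_ge0.
have h3 := le_trans h1 h2.
rewrite -(@ler_pM2r _ (expR (l * u))) ?expR_gt0// (le_trans h3)//.
rewrite -[X in _ <= X]mulrA ler_pM2l ?exprn_gt0// -expRD ler_expR le_eqVlt; apply/orP; left.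
apply/eqP; rewrite /l; field; lra.
Qed.

End subgaussian.

Lemma leq_card_bigcup (I J : finType) (Q : pred J) (F : J -> {set I}) :
  (#|\bigcup_(j | Q j) F j| <= \sum_(j | Q j) #|F j|)%N.
Proof.
elim/big_rec2: _ => [|j m B _ mB]; first by rewrite cards0.
by rewrite (leq_trans (leq_card_setU _ _).1)// leq_add2l.
Qed.

Section vc.
Variables (T J : Type) (f : J -> T -> bool).

(** VC dimension at most [D]: no [D.+1] points, repetitions allowed, are shattered. *)
Definition vc_le (D : nat) := forall y : 'I_D.+1 -> T,
  exists B : {set 'I_D.+1}, forall j, [set i | f j (y i)] <> B.

Definition traces (I : finType) (x : I -> T) (A : {set {set I}}) :=
  forall a, a \in A -> exists j, a = [set i | f j (x i)].

Lemma vc_le_shatters D (I : finType) (x : I -> T) (A : {set {set I}}) (U : {set I}) :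
  vc_le D -> traces x A -> shatters A U -> (#|U| <= D)%N.
Proof.
move=> vcD tA /shattersP sU; rewrite leqNgt; apply/negP => DU.
pose g (i : 'I_D.+1) : I := enum_val (widen_ord DU i).
have gi : injective g by move=> i j /enum_val_inj/(congr1 val)/= ?; exact: val_inj.
have [B Bj] := vcD (x \o g).
have [|a aA aU] := sU (g @: B).
  by apply/fintype.subsetP => _ /imsetP[i _ ->]; exact: enum_valP.
have [j aj] := tA _ aA; apply: (Bj j); apply/setP => i.
rewrite inE -(mem_imset _ _ gi) -aU inE enum_valP andbT aj inE//.
Qed.

Definition hdist (I : finType) (a b : {set I}) := #|[set i | (i \in a) != (i \in b)]|.

(** Normalized Hamming distance above [1 / r] between distinct members, cleared of denominators. For
    [r = 1] it leaves at most one member. *)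
Definition separated (I : finType) (r : nat) (A : {set {set I}}) :=
  [forall a in A, forall b in A, (a != b) ==> (#|I| < r * hdist a b)%N].

Variable R : realType.

(* A uniform sample of size s misses the difference of two r-separated sets with
   probability at most exp(- s / r); the union bound over pairs leaves room. *)
Lemma separating_sample (I : finType) (r s : nat) (A : {set {set I}}) :
  (0 < #|I|)%N -> (0 < r)%N -> (0 < #|A|)%N -> separated r A -> (2 * r%:R * ln (#|A|%:R : R) < s%:R) ->
  exists phi : 'I_s -> I, {in A &, injective (fun a : {set I} => [set i | phi i \in a])}.
Proof.
move=> I0 r0 A0 sep hs.
pose same (p : {set I} * {set I}) := [set phi : {ffun 'I_s -> I} |
  [forall i, (phi i \in p.1) == (phi i \in p.2)]].
pose Q := [set p in finset.setX A A | p.1 != p.2].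
have [[phi hphi]|nphi] := pselect (exists phi, phi \notin \bigcup_(p in Q) same p).
  exists phi => a b aA bA e; apply/eqP; apply: contraNT hphi => ab.
  apply/bigcupP; exists (a, b); first by rewrite !inE/= aA bA.
  by rewrite inE; apply/forallP => i; move/setP/(_ i): e; rewrite !inE/= => ->.
(* If no sample separates [A], the sets [same p] cover all samples, which forces
   [1 <= #|A| ^+ 2 * expR (- s / r)], against the choice of [s]. *)
exfalso.
have card_same p : p \in Q -> #|same p|%:R <= (#|I|%:R : R) ^+ s * expR (- (s%:R / r%:R)).
  rewrite !inE => /andP[/andP[aA bA] ab].
  have -> : #|same p| = #|ffun_on [set i | (i \in p.1) == (i \in p.2)] : pred {ffun 'I_s -> I}|.
    apply: eq_card => phi; rewrite inE; apply/forallP/ffun_onP => h i; have := h i; by rewrite inE.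
  rewrite card_ffun_on card_ord natrX.
  have /forall_inP/(_ _ aA)/forall_inP/(_ _ bA)/implyP/(_ ab) hd := sep.
  have := cardsC [set i | (i \in p.1) == (i \in p.2)].
  have -> : ~: [set i | (i \in p.1) == (i \in p.2)] = [set i | (i \in p.1) != (i \in p.2)].
    by apply/setP => i; rewrite !inE.
  rewrite -/(hdist p.1 p.2) => cI.
  have r0' : (0 : R) < r%:R by rewrite ltr0n.
  have -> : expR (- (s%:R / r%:R)) = expR (- (r%:R^-1)) ^+ s :> R.
    by rewrite -expRM_natl; congr expR; rewrite mulrN.
  rewrite -exprMn lerXn2r ?nnegrE ?mulr_ge0 ?expR_ge0//.
  apply: (@le_trans _ _ (#|I|%:R * (1 - r%:R^-1))).
    rewrite mulrBr mulr1 lerBrDr -[X in _ <= X%:R]cI natrD lerD2l.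
    by rewrite ler_pdivrMr// -natrM ler_nat mulnC ltnW.
  by rewrite ler_wpM2l//; exact: (expR_ge1Dx (- r%:R^-1)).
have : #|{ffun 'I_s -> I}|%:R <= \sum_(p in Q) (#|same p|%:R : R).
  rewrite -natr_sum ler_nat (leq_trans _ (leq_card_bigcup _ _))//.
  rewrite -cardsT; apply/subset_leq_card/fintype.subsetP => phi _.
  by apply: contra_notT nphi => h; exists phi.
rewrite card_ffun card_ord natrX => h1.
have := le_trans h1 (ler_sum _ card_same); rewrite sumr_const -[X in _ <= X]mulr_natr.
have Is : (0 : R) < #|I|%:R ^+ s by rewrite exprn_gt0// ltr0n.
rewrite -[X in _ <= X]mulrA -[X in X <= _]mulr1 ler_pM2l//.
apply/negP; rewrite -ltNge.
have A0' : (0 : R) < #|A|%:R by rewrite ltr0n.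
apply: (@le_lt_trans _ _ (expR (- (s%:R / r%:R)) * #|A|%:R ^+ 2)).
  rewrite ler_wpM2l ?expR_ge0// -natrX ler_nat expnS expn1 -cardsX.
  by apply/subset_leq_card/fintype.subsetP => p; rewrite inE => /andP[].
have -> : #|A|%:R ^+ 2 = expR (2 * ln #|A|%:R) :> R by rewrite expRM_natl lnK.
rewrite -expRD expR_lt1 addrC subr_lt0 ltr_pdivlMr ?ltr0n//.
by rewrite (le_lt_trans _ hs)// mulrAC.
Qed.

(** On a separating sample of size about [2 * 4 ^ j * ln #|A|] the members of [A] keep distinct
    traces, so Sauer-Shelah there bounds [#|A|] in terms of its own logarithm. Solving for
    [l = ln #|A|] gives [l <= 4 * j.+1 * D + 1/2]. *)
Lemma packing (I : finType) (x : I -> T) (A : {set {set I}}) (D j : nat) :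
  (0 < D)%N -> vc_le D -> traces x A -> separated (4 ^ j) A ->
  #|A|%:R <= expR (5 * j.+1 * D)%:R :> R.
Proof.
move=> D0 vcD tA sep.
have [A1|A1] := leqP #|A| 1.
  by rewrite (@le_trans _ _ 1) ?lern1 ?ler1n// -expR0 ler_expR.
have I0 : (0 < #|I|)%N.
  case: (posnP #|I|) => // I0; case/card_gt1P: A1 => a [b [_ _ /eqP]]; case.
  by apply/setP => i; have := fintype0 i I0.
have A0 : (0 < #|A|)%N by apply: ltnW.
have A0' : (0 : R) < #|A|%:R by rewrite ltr0n.
have r0 : (0 : R) < 4 ^+ j by rewrite exprn_gt0.
set l : R := ln #|A|%:R.
have l0 : 0 <= l by rewrite ln_ge0// ler1n.
have [s [sl sg]] : exists s : nat, s%:R <= 2 * 4 ^+ j * l + 1 /\ 2 * 4 ^+ j * l < s%:R.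
  have k0 : 0 <= 2 * 4 ^+ j * l by rewrite !mulr_ge0// ltW.
  exists (Num.truncn (2 * 4 ^+ j * l)).+1; have /andP[h1 h2] := truncn_itv k0.
  by rewrite h2 -natr1 lerD2r.
have [phi phiA] : exists phi : 'I_s -> I, {in A &, injective (fun a : {set I} => [set i | phi i \in a])}.
  by apply: (separating_sample I0 _ A0 sep); rewrite ?expn_gt0// natrX.
pose g (a : {set I}) := [set i | phi i \in a].
have tB : traces (x \o phi) (g @: A).
  move=> _ /imsetP[a aA ->]; have [k ->] := tA _ aA; exists k.
  by apply/setP => i; rewrite !inE.
(* With weight [4 ^- j.+1] the right side of Sauer-Shelah is at most [expR (l / 2 + 1/4)], so half
   of [l] remains on the left. *)
have z01 : 0 < (4 ^+ j.+1 : R)^-1 <= 1.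
  by rewrite invr_gt0 exprn_gt0//= invf_le1 ?exprn_gt0// exprn_ege1// ler1n.
have := sauer_shelah z01 (fun U => vc_le_shatters vcD tB).
rewrite (card_in_imset phiA) card_ord -[#|A|%:R]lnK// -/l => h.
have h1 : (1 + (4 ^+ j.+1)^-1) ^+ s <= expR (l / 2 + 1/4) :> R.
  apply: (@le_trans _ _ (expR (s%:R * (4 ^+ j.+1)^-1))).
    rewrite expRM_natl; apply: lerXn2r; rewrite ?nnegrE ?expR_ge0 ?expR_ge1Dx//.
  rewrite ler_expR ler_pdivrMr ?exprn_gt0// (le_trans sl)// exprS.
  have q1 : 1 <= 4 ^+ j :> R by rewrite exprn_ege1// ler1n.
  rewrite (_ : (l / 2 + 1/4) * (4 * 4 ^+ j) = 2 * 4 ^+ j * l + 4 ^+ j) ?lerD2l//.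
  by field.
have h2 : expR (- (2 * j.+1 * D)%:R) <= (4 ^+ j.+1)^-1 ^+ D :> R.
  rewrite expRN exprVn -exprM lef_pV2 ?posrE ?exprn_gt0 ?expR_gt0//.
  have e4 : 4 <= expR 2%:R :> R.
    rewrite -[2%:R]mulr1 expRM_natl; apply: (@le_trans _ _ ((1 + 1) ^+ 2)).
      by rewrite expr2; lra.
    by apply: lerXn2r; rewrite ?nnegrE ?expR_ge0 ?expR_ge1Dx.
  by rewrite -mulnA natrM [2%:R * _]mulrC expRM_natl lerXn2r ?nnegrE ?expR_ge0.
have : expR (- (2 * j.+1 * D)%:R) * expR l <= expR (l / 2 + 1/4).
  by rewrite (le_trans _ h1)// (le_trans _ h)// ler_wpM2r ?expR_ge0.
rewrite -expRD !ler_expR -mulnA -mulnA !natrM.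
have : (1 : R) <= j.+1%:R * D%:R by rewrite -natrM ler1n muln_gt0.
lra.
Qed.

End vc.

Section chaining.
Variables (T J : Type) (f : J -> T -> bool) (D : nat).
Hypotheses (D0 : (0 < D)%N) (vcD : vc_le f D).
Variables (R : realType) (L : R).
Hypothesis L0 : 0 <= L.

Definition rademacher (I : finType) (a : {set I}) (s : {ffun I -> bool}) : R :=
  \sum_i (-1) ^+ s i * (i \in a)%:R.

Lemma rademacherB_tail (I : finType) (a b : {set I}) (v u : R) : 0 < v -> 0 <= u ->
  (hdist a b)%:R <= v ->
  #|[set s : {ffun I -> bool} | u < rademacher a s - rademacher b s]|%:R
    <= 2 ^+ #|I| * expR (- (u ^+ 2 / (8 * v))).
Proof.
move=> v0 u0 hv.
rewrite [X in #|pred_of_set X|](_ : _ = [set s : {ffun I -> bool} |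
    u < \sum_i (-1) ^+ s i * ((i \in a)%:R - (i \in b)%:R)]); last first.
  apply/setP => s; rewrite !inE -sumrB; congr (_ < _).
  by apply: eq_bigr => i _; rewrite mulrBr.
apply: rademacher_tail1 => //; apply: le_trans hv.
rewrite /hdist -sum1_card natr_sum [leRHS]big_mkcond/=; apply: ler_sum => i _.
by rewrite inE; case: (i \in a); case: (i \in b) => /=; rewrite ?subrr ?subr0 ?sub0r ?expr0n ?sqrrN ?expr1n.
Qed.

(** The ratio is [9/4 = 4 * (3/4) ^+ 2]: from one scale to the next the chaining increments shrink
    by 3/4 and the variances by 1/4, so the tail exponents grow like [(9/4) ^+ j] and beat the
    packing exponents, linear in [j]. *)
Lemma bernoulli_pow (j : nat) : (j.+1%:R : R) <= (9/4) ^+ j.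
Proof.
elim: j => [|j IH]; first by rewrite expr0.
rewrite exprS; have : (1 : R) <= j.+1%:R by rewrite ler1n.
rewrite -[j.+2%:R]natr1; lra.
Qed.

Variables (I : finType) (x : I -> T).
Hypothesis I0 : (0 < #|I|)%N.
Let N : R := #|I|%:R.
Let w : R := Num.sqrt (N * (D%:R + L)).
(** The sum of the increments [14 * w * (3/4) ^+ i] for [i <= j], bounded by [56 * w] at every
    scale. *)
Let U j : R := 56 * w * (1 - (3/4) ^+ j.+1).

Let N0 : 0 < N. Proof. by rewrite ltr0n. Qed.
Let D1 : 1 <= D%:R :> R. Proof. by rewrite ler1n. Qed.
Let w0 : 0 <= w. Proof. exact: sqrtr_ge0. Qed.
Let w2 : w ^+ 2 = N * (D%:R + L).
Proof. by rewrite sqr_sqrtr// mulr_ge0 ?addr_ge0 ?(ltW N0)// (le_trans _ D1). Qed.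

Let expN_half (j : nat) : expR (- j%:R) <= 2^-1 ^+ j :> R.
Proof.
rewrite expRN exprVn lef_pV2 ?posrE ?exprn_gt0 ?expR_gt0//.
rewrite -[j%:R]mulr1 expRM_natl lerXn2r ?nnegrE ?expR_ge0//.
by have := expR_ge1Dx (1 : R); lra.
Qed.

(* Chaining over the scales N / 4^j: each member of A is approximated by a member
   of a maximal subfamily separated at the previous scale. *)
Lemma chaining (j : nat) (A : {set {set I}}) :
  traces f x A -> separated (4 ^ j) A ->
  #|[set s | [exists a in A, U j < rademacher a s]]|%:R
    <= 2 ^+ #|I| * expR (- L) * (1 - 2^-1 ^+ j.+1).
Proof.
elim: j A => [|j IH] A tA sep.
  have [->|[a aA]] := set_0Vmem A.
    rewrite (_ : [set s | _] = finset.set0); last first.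
      by apply/setP => s; rewrite !inE; apply/negbTE/exists_inPn => a; rewrite inE.
    by rewrite cards0 expr1 !mulr_ge0 ?expR_ge0 ?exprn_ge0//; lra.
  (* At scale [4 ^ 0] separation would exceed the diameter, so [A] has a single member; it is
     compared with the empty set, where the process vanishes. *)
  have -> : [set s | [exists a in A, U 0 < rademacher a s]] =
            [set s | U 0 < rademacher a s - rademacher finset.set0 s].
    apply/setP => s; rewrite !inE (_ : rademacher finset.set0 s = 0) ?subr0; last first.
      by apply: big1 => i _; rewrite inE mulr0.
    apply/idP/idP => [/exists_inP[b bA]|h]; last by apply/exists_inP; exists a.
    suff -> : b = a by [].
    have /forall_inP/(_ _ aA)/forall_inP/(_ _ bA)/implyP hd := sep.
    apply/eqP; apply: contraT; rewrite eq_sym => /hd.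
    by rewrite expn0 mul1n ltnNge max_card.
  have U0 : 0 <= U 0 by rewrite /U expr1 !mulr_ge0//; lra.
  apply: (le_trans (rademacherB_tail N0 U0 _)); first by rewrite ler_nat max_card.
  rewrite -mulrA ler_pM2l ?exprn_gt0// expr1.
  apply: (@le_trans _ _ (expR (- L - 1%:R))).
    rewrite ler_expR /U expr1 !exprMn w2 -opprD lerN2 ler_pdivlMr ?mulr_gt0//.
    rewrite (_ : 56 ^+ 2 * _ * _ = 196 * (D%:R + L) * N); last by field.
    by rewrite mulrA ler_pM2r//; have := D1; have := L0; lra.
  have := expN_half 1; rewrite expr1 expRD => h.
  by rewrite ler_pM2l ?expR_gt0// (le_trans h)//; lra.
pose Q (B : {set {set I}}) := (B \subset A) && separated (4 ^ j) B.
have Q0 : Q finset.set0.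
  by rewrite /Q finset.sub0set; apply/forall_inP => a; rewrite inE.
(* Maximality makes [B] a net: a member of [A] far from all of [B] could be added to it. *)
have [B /maxsetP[/andP[BA sepB] Bmax] _] := maxset_exists Q0.
have near_B a : a \in A -> exists2 b, b \in B & (4 ^ j * hdist a b <= #|I|)%N.
  move=> aA; have [aB|aB] := boolP (a \in B).
    exists a => //; rewrite /hdist (_ : [set _ | _] = finset.set0) ?cards0 ?muln0//.
    by apply/setP => i; rewrite !inE eqxx.
  apply/exists_inP; apply: contraNT aB => /exists_inPn far.
  have hsym (b c : {set I}) : hdist b c = hdist c b.
    by apply: eq_card => i; rewrite !inE eq_sym.
  suff <- : a |: B = B by rewrite !inE eqxx.
  apply: Bmax; last exact: finset.subsetUr.
  rewrite /Q finset.subUset finset.sub1set aA BA/=.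
  apply/forall_inP => b /setU1P bB; apply/forall_inP => c /setU1P cB; apply/implyP => bc.
  case: bB cB bc => [->|bB] [->|cB]; first by rewrite eqxx.
  - by move=> _; rewrite ltnNge far.
  - by move=> _; rewrite hsym ltnNge far.
  - by move=> bc; have /forall_inP/(_ _ bB)/forall_inP/(_ _ cB)/implyP/(_ bc) := sepB.
pose p (a : {set I}) := odflt a [pick b in B | 4 ^ j * hdist a b <= #|I|]%N.
have pB a : a \in A -> p a \in B /\ (4 ^ j * hdist a (p a) <= #|I|)%N.
  move=> /near_B[b bB hb]; rewrite /p; case: pickP => [c /andP[]//|/(_ b)].
  by rewrite bB hb.
have tB : traces f x B by move=> a /(fintype.subsetP BA); exact: tA.
pose u : R := 14 * w * (3/4) ^+ j.+1.
have u0 : 0 <= u by rewrite !mulr_ge0// exprn_ge0//; lra.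
have UE : U j.+1 = U j + u.
  by rewrite /U /u [in LHS]exprS; lra.
(* Exceeding [U j.+1 = U j + u] at [a] requires exceeding [U j] at the approximant [p a] or gaining
   [u] along the link from [p a] to [a]. *)
pose F a := [set s | u < rademacher a s - rademacher (p a) s].
have sub : [set s | [exists a in A, U j.+1 < rademacher a s]] \subset
   [set s | [exists a in B, U j < rademacher a s]] :|: \bigcup_(a in A) F a.
  apply/fintype.subsetP => s; rewrite !inE => /exists_inP[a aA]; rewrite UE => h.
  have [paB _] := pB _ aA; have [h1|h1] := ltP (U j) (rademacher (p a) s).
    by apply/orP; left; apply/exists_inP; exists (p a).
  by apply/orP; right; apply/bigcupP; exists a => //; rewrite inE; lra.
have hF a : a \in A -> #|F a|%:R <= 2 ^+ #|I| * expR (- (6 * j.+2%:R * (D%:R + L))).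
  move=> aA; have [_ hd] := pB _ aA.
  have v0 : 0 < N / 4 ^+ j by rewrite divr_gt0// exprn_gt0.
  apply: (le_trans (rademacherB_tail v0 u0 _)).
    by rewrite ler_pdivlMr ?exprn_gt0// -natrX -natrM ler_nat mulnC.
  rewrite ler_pM2l ?exprn_gt0// ler_expR lerN2 ler_pdivlMr; last lra.
  rewrite /u [(14 * w * _) ^+ 2]exprMn [(14 * w) ^+ 2]exprMn w2 -exprM mulnC exprM.
  have -> : (3 / 4) ^+ 2 = 9 / 4 / 4 :> R by field.
  rewrite expr_div_n.
  have b1 := bernoulli_pow j.+1.
  have p4 : 0 < 4 ^+ j :> R by rewrite exprn_gt0.
  set y : R := (9/4) ^+ j.+1 in b1 *.
  have -> : 14 ^+ 2 * (N * (D%:R + L)) * (y / 4 ^+ j.+1) =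
            (49 * y * (D%:R + L)) * (N / 4 ^+ j) by rewrite [4 ^+ j.+1]exprS; field; lra.
  have -> : 6 * j.+2%:R * (D%:R + L) * (8 * (N / 4 ^+ j)) =
            (48 * j.+2%:R * (D%:R + L)) * (N / 4 ^+ j) by ring.
  rewrite ler_pM2r//; apply: ler_wpM2r; first by have := D1; have := L0; lra.
  have := ler0n R j.+2; move: b1; lra.
have card_le : #|[set s | [exists a in A, U j.+1 < rademacher a s]]|%:R <=
    2 ^+ #|I| * expR (- L) * (1 - 2^-1 ^+ j.+1) +
    #|A|%:R * (2 ^+ #|I| * expR (- (6 * j.+2%:R * (D%:R + L)))).
  apply: (@le_trans _ _ (#|[set s | [exists a in B, U j < rademacher a s]]|%:R +
                         \sum_(a in A) #|F a|%:R)).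
    rewrite -natr_sum -natrD ler_nat (leq_trans (subset_leq_card sub))//.
    by rewrite (leq_trans (leq_card_setU _ _).1)// leq_add2l leq_card_bigcup.
  by apply: lerD; [exact: IH|rewrite [leRHS]mulr_natl -sumr_const ler_sum].
apply: (le_trans card_le).
have hA := packing R D0 vcD tA sep.
(* The union bound over links costs [5 * j.+2 * D] in the exponent against a gain of
   [6 * j.+2 * (D + L)]. The surplus covers [L + j.+2], and [2^-1 ^+ j.+2] is exactly the room left
   by the induction hypothesis. *)
have : #|A|%:R * expR (- (6 * j.+2%:R * (D%:R + L))) <= expR (- L) * 2^-1 ^+ j.+2.
  apply: (@le_trans _ _ (expR (5 * j.+2 * D)%:R * expR (- (6 * j.+2%:R * (D%:R + L))))).
    by rewrite ler_wpM2r ?expR_ge0.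
  apply: (@le_trans _ _ (expR (- L) * expR (- j.+2%:R))); last first.
    by rewrite ler_pM2l ?expR_gt0.
  rewrite -!expRD ler_expR !natrM; have j1 : (1 : R) <= j.+2%:R by rewrite ler1n.
  have h1 : 0 <= j.+2%:R * (D%:R - 1) :> R by rewrite mulr_ge0// subr_ge0.
  have h2 : 0 <= (j.+2%:R - 1) * L by rewrite mulr_ge0// subr_ge0.
  move: L0 j1 h1 h2; lra.
rewrite [2^-1 ^+ j.+2]exprS mulrCA => h.
have := ler_wpM2l (exprn_ge0 #|I| (ler0n R 2)) h.
lra.
Qed.

End chaining.

(** At scale [4 ^ #|I|] any two distinct traces are separated, since they differ somewhere and
    [#|I| < 4 ^ #|I|]; chaining thus applies to the family of all traces. *)
Lemma rademacher_sup_tail (R : realType) (T : Type) (J I : finType) (f : J -> T -> bool)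
    (D : nat) (x : I -> T) (L : R) : (0 < D)%N -> vc_le f D -> 0 <= L -> (0 < #|I|)%N ->
  #|[set s : {ffun I -> bool} | [exists j, 56 * Num.sqrt (#|I|%:R * (D%:R + L)) <
        \sum_i (-1) ^+ s i * (f j (x i))%:R]]|%:R <= 2 ^+ #|I| * expR (- L).
Proof.
move=> D0 vcD L0 I0.
pose A := [set [set i | f j (x i)] | j in J].
have tA : traces f x A by move=> _ /imsetP[j _ ->]; exists j.
have sep : separated (4 ^ #|I|) A.
  apply/forall_inP => a _; apply/forall_inP => b _; apply/implyP => ab.
  rewrite (@leq_trans (4 ^ #|I|))//; first exact: ltn_expl.
  rewrite leq_pmulr// card_gt0; apply: contraNneq ab => /setP h.
  by apply/eqP/setP => i; have := h i; rewrite !inE => /negbFE/eqP.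
have := chaining D0 vcD L0 I0 tA sep.
set w := Num.sqrt _ => h.
have c0 : 0 <= 2 ^+ #|I| * expR (- L) by rewrite mulr_ge0 ?expR_ge0 ?exprn_ge0.
apply: (@le_trans _ _ (2 ^+ #|I| * expR (- L) * (1 - 2^-1 ^+ #|I|.+1))); last first.
  by rewrite ler_piMr// gerBl exprn_ge0.
apply: le_trans h; rewrite ler_nat; apply/subset_leq_card/fintype.subsetP => s.
rewrite !inE => /existsP[j hj]; apply/exists_inP.
exists [set i | f j (x i)]; first exact: imset_f.
apply: (@le_lt_trans _ _ (56 * w)).
  by rewrite ler_piMr ?mulr_ge0 ?sqrtr_ge0// gerBl exprn_ge0//; lra.
by rewrite (lt_le_trans hj)// le_eqVlt; apply/orP; left; apply/eqP/eq_bigr => i _; rewrite inE.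
Qed.

(** * Uniform deviation for independent samples *)

Lemma rademacher_sup_norm_tail (R : realType) (T : Type) (J I : finType)
    (f : J -> T -> bool) (D : nat) (x : I -> T) (L : R) :
  (0 < D)%N -> vc_le f D -> 0 <= L -> (0 < #|I|)%N ->
  #|[set s : {ffun I -> bool} | [exists j, 56 * Num.sqrt (#|I|%:R * (D%:R + L)) <
        `|\sum_i (-1) ^+ s i * (f j (x i))%:R|]]|%:R <= 2 * (2 ^+ #|I| * expR (- L)).
Proof.
move=> D0 vcD L0 I0; have := rademacher_sup_tail x D0 vcD L0 I0.
set E := [set s | _] => hE; set E' := [set s | _].
(* Negating all signs is a bijection that exchanges the lower and upper tails. *)
pose n (s : {ffun I -> bool}) := [ffun i => ~~ s i].
have nK : involutive n by move=> s; apply/ffunP => i; rewrite !ffunE negbK.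
rewrite mulr2n mulrDl mul1r (le_trans _ (lerD hE hE))// -natrD ler_nat.
rewrite -[X in (_ <= _ + X)%N](card_imset E (inv_inj nK)).
rewrite (leq_trans _ (leq_card_setU _ _).1)//.
apply/subset_leq_card/fintype.subsetP => s; rewrite !inE => /existsP[j].
rewrite ltr_normr => /orP[h|h]; first by apply/orP; left; apply/existsP; exists j.
apply/orP; right; apply/imsetP; exists (n s); last by rewrite nK.
rewrite inE; apply/existsP; exists j; rewrite (lt_le_trans h)// -sumrN.
apply: ler_sum => i _; rewrite ffunE -mulNr.
by case: (s i); rewrite ?expr1 ?expr0 ?opprK.
Qed.

Section finite_iid.
Variables (R : realType) (V I : finType) (q : V -> R).
Hypotheses (q0 : forall v, 0 <= q v) (q1 : \sum_v q v = 1).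
Hypothesis I0 : (0 < #|I|)%N.

Definition iid_weight (v : {ffun I -> V}) : R := \prod_i q (v i).

Let N : R := #|I|%:R.
Let N0 : 0 < N. Proof. by rewrite ltr0n. Qed.

Lemma iid_weight_ge0 v : 0 <= iid_weight v.
Proof. exact: prodr_ge0. Qed.

Lemma sum_iid_weight : \sum_v iid_weight v = 1.
Proof. by rewrite -(bigA_distr_bigA (fun=> q)) big1. Qed.

(** Chernoff again: the weighted exponential moment factors over the sample, and the linear term of
    [expR_le_subgaussian] averages to zero in each factor. *)
Lemma iid_sum_tail (c : V -> R) (u : R) : 0 <= u -> (forall v, c v ^+ 2 <= 1) ->
  \sum_v q v * c v = 0 ->
  \sum_v iid_weight v * (u < \sum_i c (v i))%R%:R <= expR (- (u ^+ 2 / (8 * N))).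
Proof.
move=> u0 c1 c0; pose l := u / (4 * N).
have l0 : 0 <= l by rewrite divr_ge0// mulr_ge0// ltW.
apply: (@le_trans _ _ (\sum_v iid_weight v * expR (l * (\sum_i c (v i) - u)))).
  apply: ler_sum => v _; rewrite ler_wpM2l ?iid_weight_ge0//.
  have [h|_] := ltP u; last exact: expR_ge0.
  by rewrite -expR0 ler_expR mulr_ge0// subr_ge0 ltW.
have -> : \sum_v iid_weight v * expR (l * (\sum_i c (v i) - u)) =
    expR (- (l * u)) * \sum_(v : {ffun I -> V}) \prod_i (q (v i) * expR (l * c (v i))).
  rewrite mulr_sumr; apply: eq_bigr => v _; rewrite big_split/= mulrCA; congr (_ * _).
  by rewrite mulrBr expRD mulrC mulr_sumr expR_sum.
rewrite -(bigA_distr_bigA (fun=> fun v => q v * expR (l * c v))).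
apply: (@le_trans _ _ (expR (- (l * u)) * \prod_(i : I) expR (2 * l ^+ 2))).
  rewrite ler_pM2l ?expR_gt0//; apply: ler_prod => i _; apply/andP; split.
    by apply: sumr_ge0 => v _; rewrite mulr_ge0 ?expR_ge0.
  apply: (@le_trans _ _ (\sum_v (l * (q v * c v) + q v * expR (2 * l ^+ 2)))).
    apply: ler_sum => v _; rewrite mulrCA -mulrDr ler_wpM2l//.
    rewrite (le_trans (expR_le_subgaussian _))// lerD2l ler_expR ler_pM2l//.
    by rewrite exprMn ler_piMr// sqr_ge0.
  by rewrite big_split/= -mulr_sumr c0 mulr0 add0r -mulr_suml q1 mul1r.
rewrite prodr_const -expRM_natl -expRD ler_expR le_eqVlt; apply/orP; left.
by apply/eqP; rewrite /l -/N; field; rewrite gt_eqF.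
Qed.

Variables (J : finType) (f : J -> V -> bool) (D : nat).
Hypotheses (D0 : (0 < D)%N) (vcD : vc_le f D).
Variable L : R.
Hypothesis L0 : 0 <= L.

Let m j : R := \sum_v q v * (f j v)%:R.
Let emp j (v : {ffun I -> V}) : R := \sum_i (f j (v i))%:R.
Let t : R := 56 * Num.sqrt (N * (D%:R + L)).

Let t2 : t ^+ 2 = 3136 * (N * (D%:R + L)).
Proof.
rewrite exprMn sqr_sqrtr; first by ring.
by rewrite mulr_ge0 ?addr_ge0 ?(ltW N0).
Qed.

Let t0 : 0 <= t. Proof. by rewrite mulr_ge0// sqrtr_ge0. Qed.

(** Each one-sided tail at [2 * t] weighs at most 1/4, because [t ^+ 2] is at least [3136 * N]. This
    supplies the ghost sample close to the mean. *)
Let concentration j :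
  2^-1 <= \sum_v iid_weight v * (`|emp j v - N * m j| <= 2 * t)%R%:R.
Proof.
have m01 : 0 <= m j <= 1.
  rewrite sumr_ge0/=; last by move=> v _; rewrite mulr_ge0.
  by rewrite -q1; apply: ler_sum => v _; case: (f j v); rewrite ?mulr1 ?mulr0.
have c1 v : ((f j v)%:R - m j) ^+ 2 <= 1 by case: (f j v) => /=; nra.
have cN1 v : (m j - (f j v)%:R) ^+ 2 <= 1 by rewrite -sqrrN opprB.
have c0 : \sum_v q v * ((f j v)%:R - m j) = 0.
  under eq_bigr do rewrite mulrBr; rewrite sumrB -mulr_suml q1 mul1r; exact: subrr.
have cN0 : \sum_v q v * (m j - (f j v)%:R) = 0.
  by apply: oppr_inj; rewrite oppr0 -sumrN -[RHS]c0; apply: eq_bigr => v _; rewrite -mulrN opprB.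
have t20 : 0 <= 2 * t by rewrite mulr_ge0.
have h1 := iid_sum_tail t20 c1 c0; have h2 := iid_sum_tail t20 cN1 cN0.
have hE : expR (- ((2 * t) ^+ 2 / (8 * N))) <= 4^-1.
  rewrite expRN lef_pV2 ?posrE ?expR_gt0//.
  apply: (@le_trans _ _ (expR 3)); first by have := expR_ge1Dx (3 : R); lra.
  rewrite ler_expR exprMn t2 ler_pdivlMr ?mulr_gt0//.
  have : 1 <= D%:R + L by rewrite (@le_trans _ _ D%:R) ?ler1n// lerDl.
  move: (D%:R + L) => y y1; rewrite -natrX !mulrA [_ * N * y]mulrAC ler_pM2r//; lra.
have : \sum_v iid_weight v <= \sum_v iid_weight v * (`|emp j v - N * m j| <= 2 * t)%R%:R +
   (\sum_v iid_weight v * (2 * t < \sum_i ((f j (v i))%:R - m j))%R%:R +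
    \sum_v iid_weight v * (2 * t < \sum_i (m j - (f j (v i))%:R))%R%:R).
  rewrite -!big_split/=; apply: ler_sum => v _.
  rewrite -!mulrDr ler_peMr ?iid_weight_ge0//.
  rewrite !sumrB sumr_const -[m j *+ _]mulr_natl -/N -/(emp j v).
  have [//|] := leP `|emp j v - N * m j| (2 * t).
    by rewrite lerDl addr_ge0.
  by rewrite ltr_normr opprB => /orP[]->; rewrite add0r ?lerDl ?lerDr.
by rewrite sum_iid_weight; lra.
Qed.

Let swap (s : {ffun I -> bool}) (p : {ffun I -> V} * {ffun I -> V}) :=
  ([ffun i => if s i then p.2 i else p.1 i], [ffun i => if s i then p.1 i else p.2 i]).

Let swapK s : involutive (swap s).
Proof.
by move=> [v w]; congr pair; apply/ffunP => i; rewrite !ffunE/=; case: (s i).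
Qed.

(* Symmetrization: a ghost sample is close to the mean with probability 1/2,
   and exchanging coordinates of the two samples preserves their joint law. *)
Lemma finite_uniform_deviation :
  \sum_v iid_weight v * [exists j, 224 * Num.sqrt (#|I|%:R * (D%:R + L)) <
      `|\sum_i (f j (v i))%:R - #|I|%:R * \sum_u q u * (f j u)%:R|]%R%:R <= 8 * expR (- L).
Proof.
(* Of the deviation [4 * t], the ghost sample's own error takes [2 * t]; the remaining [2 * t] is
   shared between two Rademacher sums. *)
rewrite -/N (_ : 224 * _ = 4 * t); last by rewrite /t; ring.
under eq_bigr => v _ do under eq_existsb => j do rewrite -/(m j) -/(emp j v).
pose H (p : {ffun I -> V} * {ffun I -> V}) := [exists j, 2 * t < `|emp j p.2 - emp j p.1|].
pose W (p : {ffun I -> V} * {ffun I -> V}) := iid_weight p.1 * iid_weight p.2.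
have W0 p : 0 <= W p by rewrite mulr_ge0 ?iid_weight_ge0.
have W1 : \sum_p W p = 1.
  rewrite -(pair_bigA _ (fun v w => iid_weight v * iid_weight w))/=.
  by under eq_bigr do rewrite -mulr_sumr sum_iid_weight mulr1; exact: sum_iid_weight.
have ghost : \sum_v iid_weight v * [exists j, 4 * t < `|emp j v - N * m j|]%R%:R <=
             2 * \sum_p W p * (H p)%:R.
  rewrite -(pair_bigA _ (fun v w => W (v, w) * (H (v, w))%:R))/= mulr_sumr.
  apply: ler_sum => v _.
  case: existsP => [[j hj]|_]; last first.
    by rewrite mulr0 mulr_ge0// sumr_ge0// => w _; rewrite mulr_ge0.
  under eq_bigr do rewrite /W/= -mulrA.
  rewrite -mulr_sumr mulrCA ler_wpM2l ?iid_weight_ge0//.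
  have : \sum_w iid_weight w * (`|emp j w - N * m j| <= 2 * t)%R%:R <=
         \sum_w iid_weight w * (H (v, w))%:R.
    apply: ler_sum => w _; rewrite ler_wpM2l ?iid_weight_ge0//.
    have [h|//] := leP `|emp j w - N * m j| (2 * t).
    rewrite (_ : H _) //; apply/existsP; exists j => /=.
    have := ler_distD (emp j w) (emp j v) (N * m j).
    by rewrite [`|emp j v - emp j w|]distrC; lra.
  move=> h4; have h3 := concentration j; rewrite -[true%:R]/(1 : R); lra.
have swapE s : \sum_p W p * (H p)%:R = \sum_p W p * (H (swap s p))%:R.
  rewrite (reindex_inj (inv_inj (swapK s))); apply: eq_bigr => p _; congr (_ * _).
  rewrite /W /iid_weight -!big_split/=; apply: eq_bigr => i _.
  by rewrite !ffunE; case: (s i); rewrite // mulrC.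
have avg : 2 ^+ #|I| * \sum_p W p * (H p)%:R =
           \sum_p W p * #|[set s | H (swap s p)]|%:R.
  have -> : 2 ^+ #|I| * \sum_p W p * (H p)%:R =
            \sum_(s : {ffun I -> bool}) \sum_p W p * (H (swap s p))%:R.
    under [RHS]eq_bigr => s _ do rewrite -(swapE s).
    by rewrite sumr_const card_ffun card_bool -[RHS]mulr_natl natrX.
  rewrite exchange_big/=; apply: eq_bigr => p _; rewrite -mulr_sumr; congr (_ * _).
  rewrite -sum1_card natr_sum [RHS]big_mkcond/=; apply: eq_bigr => s _.
  by rewrite inE; case: (H _).
pose E (v : {ffun I -> V}) := [set s : {ffun I -> bool} |
  [exists j, t < `|\sum_i (-1) ^+ s i * (f j (v i))%:R|]].
(* For a fixed pair of samples, the swapped difference is a difference of two Rademacher sums with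
   the same signs, one of which must exceed [t] in absolute value. *)
have cond p : #|[set s | H (swap s p)]|%:R <= 2 ^+ #|I| * (4 * expR (- L)).
  have hE v := rademacher_sup_norm_tail v D0 vcD L0 I0.
  apply: (@le_trans _ _ (#|E p.1|%:R + #|E p.2|%:R)); last first.
    by have := hE p.1; have := hE p.2; rewrite -/N -/t -!/(E _); lra.
  rewrite -natrD ler_nat (leq_trans _ (leq_card_setU _ _).1)//.
  apply/subset_leq_card/fintype.subsetP => s; rewrite !inE => /existsP[j].
  have -> : emp j (swap s p).2 - emp j (swap s p).1 =
     \sum_i (-1) ^+ s i * (f j (p.2 i))%:R - \sum_i (-1) ^+ s i * (f j (p.1 i))%:R.
    rewrite -!sumrB; apply: eq_bigr => i _; rewrite !ffunE.
    by case: (s i); rewrite ?expr1 ?expr0; lra.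
  set a := (X in X - _); set b := (X in _ - X) => h.
  have [ta|ta] := ltP t `|a|; first by apply/orP; right; apply/existsP; exists j.
  apply/orP; left; apply/existsP; exists j; rewrite -/b.
  by have := ler_normB a b; lra.
have : 2 ^+ #|I| * \sum_p W p * (H p)%:R <= 2 ^+ #|I| * (4 * expR (- L)).
  rewrite avg (@le_trans _ _ (\sum_p W p * (2 ^+ #|I| * (4 * expR (- L)))))//; last first.
    by rewrite -mulr_suml W1 mul1r.
  by apply: ler_sum => p _; apply: ler_wpM2l.
by rewrite ler_pM2l ?exprn_gt0// => h; apply: (le_trans ghost); lra.
Qed.

End finite_iid.

(** Any [n.+1] vectors of dimension [n] satisfy a linear relation [w] with some negative
    coefficient. The points with [0 <= w] cannot be cut out: every term of the relation would be
    nonpositive and one of them negative, yet the sum is zero. *)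
Lemma vc_le_halfspaces (R : realFieldType) (n : nat) (T J : Type) (f : J -> T -> bool)
    (phi : T -> 'rV[R]_n) (a : J -> 'cV[R]_n) :
  (forall j z, f j z = ((phi z *m a j) 0 0 <= 0)) -> vc_le f n.
Proof.
move=> fE y; pose U := \matrix_i phi (y i) : 'M[R]_(n.+1, n).
have [w [i0 wi0 wU]] : exists w : 'rV[R]_n.+1, exists2 i0, w 0 i0 < 0 & w *m U = 0.
  have : kermx U != 0.
    rewrite kermx_eq0 /row_free; apply: contraTneq (rank_leq_col U) => ->.
    by rewrite ltnn.
  case/rowV0Pn => w /sub_kermxP wU /rV0Pn[i wi].
  have [wi0|wi0] := ltP (w 0 i) 0; first by exists w, i.
  exists (- w); exists i; last by rewrite mulNmx wU oppr0.
  by rewrite mxE oppr_lt0 lt_neqAle eq_sym wi.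
exists [set i | 0 <= w 0 i] => j /setP fB.
have sgn i : w 0 i * (phi (y i) *m a j) 0 0 <= 0.
  have := fB i; rewrite !inE fE.
  have [wi /idP h|wi /negbT] := leP 0 (w 0 i); first by rewrite mulr_ge0_le0.
  by rewrite -ltNge => h; rewrite mulr_le0_ge0 ?ltW.
have : \sum_i w 0 i * (phi (y i) *m a j) 0 0 < 0.
  rewrite (bigD1 i0)//= ltr_wnDr ?sumr_le0//.
  have := fB i0; rewrite !inE fE [0 <= w 0 i0]leNgt wi0/= => /negbT.
  by rewrite -ltNge => h; rewrite nmulr_rlt0.
suff -> : \sum_i w 0 i * (phi (y i) *m a j) 0 0 = 0 by rewrite ltxx.
have wUa : (w *m U *m a j) 0 0 = 0 by rewrite wU mul0mx mxE.
rewrite -[RHS]wUa -mulmxA [RHS]mxE; apply: eq_bigr => i _; congr (_ * _).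
have : row i (U *m a j) = phi (y i) *m a j by rewrite row_mul rowK.
by move/rowP/(_ 0); rewrite [LHS]mxE.
Qed.

Local Open Scope classical_set_scope.

Lemma probability_finite_partition (R : realType) (d : measure_display)
    (T : measurableType d) (P : probability T R) (V : finType) (X : T -> V) (p : pred V) :
  (forall v, measurable [set w | X w = v]) ->
  P [set w | p (X w)] = (\sum_(v | p v) P [set w | X w = v])%E.
Proof.
move=> mX.
have -> : [set w | p (X w)] = \bigcup_(v in [set` enum p]) [set w | X w = v].
  apply/seteqP; split => w /=; first by move=> pX; exists (X w); rewrite //= mem_enum.
  by case=> v /=; rewrite mem_enum => pv Xv; rewrite Xv.
rewrite measure_fin_bigcup//; last by move=> u v _ _ [w [<- <-]].
by rewrite -fsbig_seq ?enum_uniq// big_enum.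
Qed.

Lemma measurable_natr_bool (R : realType) (d : measure_display)
    (T : measurableType d) (b : T -> bool) :
  measurable [set x | b x] -> measurable_fun setT (fun x => (b x)%:R : R).
Proof.
move=> mb; rewrite (_ : (fun x => _) = \1_[set x | b x]).
  exact: measurable_indic.
apply/funext => x; rewrite indicE; congr (_%:R).
by case: (boolP (b x)) => bx; [rewrite mem_set|rewrite memNset//; exact/negP].
Qed.

Lemma measurable_set_lt (R : realType) (d : measure_display)
    (T : measurableType d) (f g : T -> R) :
  measurable_fun setT f -> measurable_fun setT g -> measurable [set x | f x < g x].
Proof.
move=> mf mg; rewrite (_ : [set x | _] = setT `&` (fun x => f x < g x) @^-1` [set true]).
  by apply: measurable_fun_ltr.
by rewrite setTI.
Qed.

Section uniform_deviation.
Variables (R : realType) (dT dO : measure_display) (T : measurableType dT).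
Variables (Omega : measurableType dO) (P : probability Omega R) (D : probability T R).
Variables (N : nat) (S : 'I_N -> Omega -> T).
Hypotheses (N0 : (0 < N)%N) (mS : forall i, measurable_fun setT (S i)).
Hypotheses (iS : mutually_independent P S) (lawS : forall i, has_law P (S i) D).
Variables (f : nat -> T -> bool) (K : nat) (L : R).
Hypotheses (mf : forall j, measurable [set z | f j z]).
Hypotheses (K0 : (0 < K)%N) (vcK : vc_le f K) (L0 : 0 <= L).

Definition deviation (j : nat) (w : Omega) : R :=
  `|\sum_(i < N) (f j (S i w))%:R - N%:R * fine (D [set z | f j z])|.

Let t : R := 224 * Num.sqrt (N%:R * (K%:R + L)).

(** The deviations depend on a point only through the vector [X] of its [n] labels, so the sample is
    replaced by an i.i.d. sample in the finite type [V]. *)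
Lemma finite_class_deviation (n : nat) :
  (P [set w | [exists j : 'I_n, t < deviation j w]%R] <= (8 * expR (- L))%:E)%E.
Proof.
pose V := {ffun 'I_n -> bool}.
pose X (z : T) : V := [ffun j : 'I_n => f j z].
have mX v : measurable [set z | X z = v].
  have -> : [set z | X z = v] =
      \bigcap_(j in [set: 'I_n]) (if v j then [set z | f j z] else ~` [set z | f j z]).
    apply/seteqP; split => z /= h.
      by move=> j _; rewrite -h ffunE; case: ifPn => // /negP.
    apply/ffunP => j; rewrite ffunE; have := h j I.
    by case: (v j) => //= /negP/negbTE.
  apply: fin_bigcap_measurable; first exact: finite_finset.
  by move=> j _; case: (v j); [exact: mf|exact/measurableC/mf].
have [z0 _] : exists z : T, True.
  apply: contrapT => nT; have := @probability_setT _ _ _ D.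
  rewrite (_ : setT = set0) ?measure0.
    by move/eqP; rewrite eqe eq_sym oner_eq0.
  by apply/seteqP; split => // z _; apply: nT; exists z.
(* A point of each cell; empty cells get [z0], which is harmless as their weight [q] is zero. *)
pose rep (v : V) : T := xget z0 [set z | X z = v].
pose q (v : V) : R := fine (D [set z | X z = v]).
have qE v : (q v)%:E = D [set z | X z = v] by rewrite fineK// fin_num_measure.
have q0 v : 0 <= q v by rewrite fine_ge0.
have q1 : \sum_v q v = 1.
  apply: EFin_inj; rewrite -sumEFin; under eq_bigr do rewrite qE.
  rewrite -(probability_finite_partition D xpredT mX) (_ : [set w | _] = setT).
    exact: probability_setT.
  by apply/seteqP; split.
have repE z (j : 'I_n) : f j (rep (X z)) = f j z.
  have : X (rep (X z)) = X z by rewrite /rep; case: xgetP => [y _ //|/(_ z)/=].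
  by move/ffunP/(_ j); rewrite !ffunE.
pose f' (j : 'I_n) (v : V) := f j (rep v).
have vc' : vc_le f' K.
  by move=> y; have [B hB] := vcK (rep \o y); exists B => j; exact: hB.
have I0 : (0 < #|'I_N|)%N by rewrite card_ord.
have mean (j : 'I_n) : \sum_u q u * (f' j u)%:R = fine (D [set z | f j z]).
  have -> : [set z | f j z] = [set z | f' j (X z)].
    by apply/seteqP; split => z /=; rewrite /f' repE.
  rewrite (probability_finite_partition D (f' j) mX).
  rewrite (eq_bigr (fun u => (q u)%:E)); last by move=> u _; rewrite qE.
  rewrite sumEFin/= [RHS]big_mkcond/=; apply: eq_bigr => u _.
  by case: (f' j u); rewrite ?mulr1 ?mulr0.
have := finite_uniform_deviation q0 q1 I0 K0 vc' L0.
rewrite card_ord -/t => fin.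
pose Y w : {ffun 'I_N -> V} := [ffun i => X (S i w)].
have YE v : [set w | Y w = v] =
    \bigcap_(i in [set` [set: 'I_N]%SET]) (S i @^-1` [set z | X z = v i]).
  apply/seteqP; split => w /= h.
    by move=> i _ /=; rewrite -h ffunE.
  by apply/ffunP => i; rewrite ffunE; apply: h => /=; rewrite inE.
have mY v : measurable [set w | Y w = v].
  rewrite YE; apply: fin_bigcap_measurable; first exact: finite_finset.
  by move=> i _; rewrite -[X in measurable X]setTI; exact: mS.
have PY v : P [set w | Y w = v] = (iid_weight q v)%:E.
  rewrite YE iS; last by move=> i; exact: mX.
  rewrite /iid_weight -prodEFin; apply: eq_big => [i|i _]; first by rewrite inE.
  by rewrite lawS ?qE.
pose bad (v : {ffun 'I_N -> V}) := [exists j, t < `|\sum_i (f' j (v i))%:R - N%:R * \sum_u q u * (f' j u)%:R|].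
have -> : [set w | [exists j : 'I_n, t < deviation j w]] = [set w | bad (Y w)].
  have e w : bad (Y w) = [exists j : 'I_n, t < deviation j w].
    apply: eq_existsb => j; rewrite mean /deviation; congr (_ < `|_ - _|).
    by apply: eq_bigr => i _; rewrite ffunE /f' repE.
  by apply/seteqP; split => w /=; rewrite e.
rewrite (probability_finite_partition P bad mY).
under eq_bigr do rewrite PY.
rewrite sumEFin lee_fin; apply: le_trans fin; rewrite big_mkcond/=.
by apply: ler_sum => v _; rewrite -/(bad v); case: (bad v); rewrite ?mulr1 ?mulr0.
Qed.

Lemma measurable_deviation (j : nat) : measurable_fun setT (deviation j).
Proof.
apply: measurableT_comp => //; apply: measurable_funB => //.
apply: measurable_sum => i.
exact: (measurableT_comp (measurable_natr_bool (mf j)) (mS i)).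
Qed.

(** The bound for the first [n] members does not depend on [n], so it passes to the increasing union
    by continuity from below. *)
Lemma countable_class_deviation :
  (P (\bigcup_j [set w | (t < deviation j w)%R]) <= (8 * expR (- L))%:E)%E.
Proof.
pose E n := [set w | [exists j : 'I_n, t < deviation j w]].
have mlt j : measurable [set w | t < deviation j w].
  by apply: measurable_set_lt => //; exact: measurable_deviation.
have EE n : E n = \bigcup_(j in `I_n) [set w | t < deviation j w].
  apply/seteqP; split => w /=; first by case/existsP => j hj; exists j => /=.
  by case=> j /= jn hj; apply/existsP; exists (Ordinal jn).
have mE n : measurable (E n) by rewrite EE; exact: bigcup_measurable.
have EU : \bigcup_j [set w | t < deviation j w] = \bigcup_n E n.
  apply/seteqP; split => w; case=> [j _ /= h].
    by exists j.+1 => //; apply/existsP; exists ord_max.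
  by case/existsP: h => i hi; exists i.
have nd : {homo E : n m / (n <= m)%N >-> (n <= m)%O}.
  move=> n m nm; rewrite !EE; apply/subsetPset => w [j /= jn hw].
  by exists j => //=; exact: leq_trans jn nm.
rewrite EU.
have cv := nondecreasing_cvg_mu (mu := P) mE (bigcup_measurable (fun n _ => mE n)) nd.
rewrite -(cvg_lim _ cv)//; apply: lime_le; first by apply/cvg_ex; eexists; exact: cv.
by apply: nearW => n; exact: finite_class_deviation.
Qed.

End uniform_deviation.

(** * Halfspaces *)

Section measurability.
Variable R : realType.

Lemma measurable_mx_entry (m n : nat) (i : 'I_m) (j : 'I_n) :
  measurable_fun setT (fun A : 'M[R]_(m, n) => A i j).
Proof.
move=> _ Y mY; apply: sub_sigma_algebra; exists (i, j) => //=.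
by exists Y.
Qed.

Context {d : measure_display} {X : measurableType d}.

Lemma measurable_mx_entry_comp (m n : nat) (A : X -> 'M[R]_(m, n)) (i : 'I_m) (j : 'I_n) :
  measurable_fun setT A -> measurable_fun setT (fun p => A p i j).
Proof. by move=> mA; apply: measurableT_comp (measurable_mx_entry i j) mA. Qed.

Lemma measurable_mulmx (m n p : nat) (A : X -> 'M[R]_(m, n)) (B : X -> 'M[R]_(n, p)) i j :
  (forall i j, measurable_fun setT (fun x => A x i j)) ->
  (forall i j, measurable_fun setT (fun x => B x i j)) ->
  measurable_fun setT (fun x => (A x *m B x) i j).
Proof.
move=> mA mB; rewrite (_ : (fun x => _) = fun x => \sum_l A x i l * B x l j).
  by apply: measurable_sum => l; exact: measurable_funM.
by apply/funext => x; rewrite mxE.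
Qed.

Lemma measurable_compressive_classifier (k n : nat) (A : X -> 'M[R]_(k, n))
    (a : X -> 'cV[R]_k) (b : X -> R) (x : X -> 'cV[R]_n) :
  (forall i j, measurable_fun setT (fun p => A p i j)) ->
  (forall i j, measurable_fun setT (fun p => a p i j)) ->
  measurable_fun setT b ->
  (forall i j, measurable_fun setT (fun p => x p i j)) ->
  measurable_fun setT (fun p => compressive_classifier (A p) (a p) (b p) (x p)).
Proof.
move=> mA ma mb mx; apply: measurable_funD => //.
apply: measurable_mulmx => i j; last exact: measurable_mulmx.
rewrite (_ : (fun p => _) = fun p => a p j i) //.
by apply/funext => p; rewrite mxE.
Qed.

Lemma measurable_set_le (f g : X -> R) :
  measurable_fun setT f -> measurable_fun setT g -> measurable [set x | f x <= g x].
Proof.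
move=> mf mg; rewrite (_ : [set x | _] = setT `&` (fun x => f x <= g x) @^-1` [set true]).
  by apply: measurable_fun_ler.
by rewrite setTI.
Qed.

End measurability.

Section halfspaces.
Variables (R : realType) (k d : nat).

(** Enumerates rational triples through their countable encoding. A number encoding none gets
    [(0, 0, 0)], whose halfspace is the whole space. *)
Definition rational_halfspace (n : nat) : 'cV[R]_k * R * R :=
  if unpickle n is Some q then
    let: (a, b, c) := (q : 'cV[rat]_k * rat * rat) in
    (map_mx ratr a, ratr b, ratr c)
  else (0, 0, 0).

(* The margin c enlarges closed halfspaces slightly, so that every closed
   halfspace is the pointwise limit of rational ones. *)
Definition halfspace (m : 'M[R]_(k, d)) (n : nat) (z : 'cV[R]_d * R) : bool :=
  let: (a, b, c) := rational_halfspace n in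
  compressive_classifier m a b z.1 * z.2 <= c.

(** In the coordinates [(y * M x, y, 1)] membership is a sign condition on one linear functional;
    the last coordinate carries the margin. *)
Lemma vc_le_halfspace (m : 'M[R]_(k, d)) : vc_le (halfspace m) (k + 1 + 1).
Proof.
apply: (@vc_le_halfspaces R _ _ _ _
  (fun z => row_mx (row_mx (z.2 *: (m *m z.1)^T) (z.2%:M)) 1%:M)
  (fun n => let: (a, b, c) := rational_halfspace n in col_mx (col_mx a b%:M) (- c)%:M)).
move=> n z; rewrite /halfspace; case: (rational_halfspace n) => [[a b] c].
rewrite !mul_row_col mul1mx 2!mxE -scalar_mxM -scalemxAl 3!mxE !mxE !eqxx !mulr1n.
rewrite subr_le0 /compressive_classifier /dotv mulrDl; congr (_ + _ <= _).
  rewrite mulrC; congr (_ * _); rewrite !mxE; apply: eq_bigr => l _.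
  by rewrite !mxE mulrC.
by rewrite mulrC.
Qed.

(** The sequence is chosen before [m] and [z], so that one sequence serves all sample points and the
    whole distribution at once. *)
Lemma halfspace_approx (a : 'cV[R]_k) (b : R) : exists n : nat -> nat,
  forall (m : 'M[R]_(k, d)) (z : 'cV[R]_d * R),
    \forall i \near \oo,
      halfspace m (n i) z = (compressive_classifier m a b z.1 * z.2 <= 0).
Proof.
have dense (x : R) (i : nat) : exists q : rat, `|ratr q - x| <= i.+1%:R^-1 ^+ 2.
  have e0 : 0 < i.+1%:R^-1 ^+ 2 :> R by rewrite exprn_gt0// invr_gt0.
  have xe : x - i.+1%:R^-1 ^+ 2 < x + i.+1%:R^-1 ^+ 2.
    by rewrite ltrBlDr -addrA ltrDl addr_gt0.
  have [q] := rat_in_itvoo xe.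
  rewrite in_itv/= => /andP[/ltW h1 /ltW h2]; exists q; rewrite ler_norml.
  by apply/andP; split; [rewrite lerBrDl|rewrite lerBlDl].
have /choice[q hq] : forall x : R, exists q : nat -> rat, forall i, `|ratr (q i) - x| <= i.+1%:R^-1 ^+ 2.
  by move=> x; have /choice[q hq] := dense x; exists q.
(* Precision [i.+1 ^- 2] against margin [i.+1 ^- 1]: the approximation error eventually falls below
   the margin, which keeps points with value at most 0, while points with value [v > 0] leave once
   [2 / i.+1 < v]. *)
pose Q i : 'cV[rat]_k * rat * rat := (\col_l q (a l 0) i, q b i, i.+1%:R^-1).
exists (fun i => pickle (Q i)) => m z.
pose v := compressive_classifier m a b z.1 * z.2.
pose vi i := compressive_classifier m (map_mx ratr (Q i).1.1) (ratr (Q i).1.2) z.1 * z.2.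
have hE i : halfspace m (pickle (Q i)) z = (vi i <= i.+1%:R^-1).
  have rE : ratr i.+1%:R^-1 = i.+1%:R^-1 :> R.
    by rewrite fmorphV; congr (_^-1); exact: ratr_nat.
  by rewrite /halfspace /rational_halfspace pickleK -rE.
have cE (a' : 'cV[R]_k) (b' : R) : compressive_classifier m a' b' z.1 * z.2 =
    \sum_l a' l 0 * ((m *m z.1) l 0 * z.2) + b' * z.2.
  rewrite /compressive_classifier /dotv [X in X + _]mxE mulrDl mulr_suml.
  by congr (_ + _); apply: eq_bigr => l _; rewrite [_^T _ _]mxE mulrA.
pose C : R := \sum_l `|(m *m z.1) l 0 * z.2| + `|z.2|.
have diff i : `|vi i - v| <= i.+1%:R^-1 ^+ 2 * C.
  have -> : vi i - v = \sum_l (ratr (q (a l 0) i) - a l 0) * ((m *m z.1) l 0 * z.2) +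
      (ratr (q b i) - b) * z.2.
    rewrite /vi /v !cE opprD addrACA -sumrB -mulrBl; congr (_ + _).
    by apply: eq_bigr => l _; rewrite -mulrBl; congr ((_ - _) * _); rewrite !mxE.
  rewrite (le_trans (ler_normD _ _))// mulrDr lerD//; last first.
    by rewrite normrM ler_wpM2r.
  rewrite mulr_sumr (le_trans (ler_norm_sum _ _ _))//; apply: ler_sum => l _.
  by rewrite normrM ler_wpM2r.
near=> i; rewrite hE -/v.
have iC : C <= i.+1%:R.
  by rewrite -natr1 ler_wpDr//; near: i; exact: nbhs_infty_ger.
have iv : 2 / v < i.+1%:R.
  by rewrite -[i.+1%:R]natr1 ltr_pwDr//; near: i; exact: nbhs_infty_ger.
have := diff i; set e : R := i.+1%:R^-1 => hd.
have e0 : 0 < e by rewrite invr_gt0.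
have eC : e ^+ 2 * C <= e.
  rewrite expr2 -mulrA ger_pMr// /e mulrC ler_pdivrMr ?mul1r ?ltr0n//.
have := le_trans hd eC; rewrite ler_norml => /andP[h1 h2].
have [v0|v0] := leP v 0; first by apply/idP; lra.
apply/negbTE; rewrite -ltNge.
have : 2 * e < v by rewrite /e ltr_pdivrMr ?ltr0n// mulrC -ltr_pdivrMr.
lra.
Unshelve. all: by end_near.
Qed.

End halfspaces.

(** Dominated convergence for indicators. *)
Lemma cvg_measure_eventually_eq (R : realType) (d : measure_display)
    (T : measurableType d) (D : probability T R) (b_ : nat -> T -> bool) (b : T -> bool) :
  (forall i, measurable [set z | b_ i z]) -> measurable [set z | b z] ->
  (forall z, \forall i \near \oo, b_ i z = b z) ->
  D [set z | b_ i z] @[i --> \oo] --> D [set z | b z].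
Proof.
move=> mb_ mb bb.
have mE (c : T -> bool) : measurable [set z | c z] ->
    measurable_fun setT (fun z => (c z)%:R%:E : \bar R).
  by move=> mc; apply/measurable_EFinP; exact: measurable_natr_bool.
have int (c : T -> bool) : measurable [set z | c z] ->
    (\int[D]_z (c z)%:R%:E)%E = D [set z | c z].
  move=> mc; rewrite -[in RHS](setIT [set z | c z]) -integral_indic//.
  apply: eq_integral => z _.
  rewrite indicE; congr (_%:R%:E).
  by case: (boolP (c z)) => cz; [rewrite mem_set|rewrite memNset//; exact/negP].
have [||| _ _] := @dominated_convergence _ _ _ D setT measurableT
  (fun i z => (b_ i z)%:R%:E) (fun z => (b z)%:R%:E) (cst 1%E)
  (fun i => mE _ (mb_ i)) (mE _ mb).
- apply: aeW => z _; apply: cvg_near_cst.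
  by apply: filterS (bb z) => i ->.
- exact: (finite_measure_integrable_cst D 1).
- by apply: aeW => z i _; case: (b_ i z); rewrite /= ?normr1 ?normr0 lee_fin.
by rewrite int//; under eq_fun do rewrite int//.
Qed.

Section independence.
Variables (R : realType) (dO d1 d2 : measure_display).
Variables (Omega : measurableType dO) (T1 : measurableType d1) (T2 : measurableType d2).
Variables (P : probability Omega R) (X : Omega -> T1) (Y : Omega -> T2).
Hypotheses (mX : measurable_fun setT X) (mY : measurable_fun setT Y).

Lemma independent2_sym : independent2 P X Y -> independent2 P Y X.
Proof. by move=> h A B mA mB; rewrite setIC h// muleC. Qed.

(** Conditioning on [X]: by independence the law of the pair is the product of the marginals, so a
    bound on every section integrates to the same bound. *)
Lemma independent2_section_le (E : set (T1 * T2)) (p : R) : 0 <= p ->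
  independent2 P X Y -> measurable E ->
  (forall x, P [set w | E (x, Y w)] <= p%:E)%E ->
  (P [set w | E (X w, Y w)] <= p%:E)%E.
Proof.
move=> p0 ind mE hE.
pose fX : {mfun Omega >-> T1} := HB.pack X (isMeasurableFun.Build _ _ _ _ X mX).
pose fY : {mfun Omega >-> T2} := HB.pack Y (isMeasurableFun.Build _ _ _ _ Y mY).
have mXY : measurable_fun setT (fun w => (X w, Y w)) by exact: measurable_fun_pair.
pose fXY : {mfun Omega >-> (T1 * T2)%type} :=
  HB.pack (fun w => (X w, Y w)) (isMeasurableFun.Build _ _ _ _ (fun w => (X w, Y w)) mXY).
have <- : (distribution P fX \x distribution P fY)%E E = P [set w | E (X w, Y w)].
  by apply: (product_measure_unique (m' := distribution P fXY)) => // A B mA mB; exact: ind.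
rewrite /product_measure1.
apply: (@le_trans _ _ (\int[distribution P fX]_x (cst p%:E) x)%E).
  apply: ge0_le_integral => //.
  - exact: measurable_fun_xsection.
  - move=> x _; apply: le_trans (hE x).
    rewrite (_ : [set w | _] = Y @^-1` xsection E x)//.
    by apply/seteqP; split => w /=; rewrite /xsection/= in_setE.
by rewrite integral_cst// [X in (_ * X)%E](@probability_setT _ _ _ (distribution P fX)) mule1.
Qed.

End independence.

Section sample.
Variables (R : realType) (k d N : nat) (D : probability ('cV[R]_d * R)%type R).
Variables (dO : measure_display) (Omega : measurableType dO) (P : probability Omega R).
Variables (S : 'I_N -> {RV P >-> ('cV[R]_d * R)%type}) (M : {RV P >-> 'M[R]_(k, d)}).

Lemma measurable_training_set : measurable_fun setT (training_set S).
Proof.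
apply/measurable_fun_tnthP => i.
rewrite (_ : _ \o _ = S i); last by apply/funext => w; rewrite /= tnth_mktuple.
exact: measurable_funP.
Qed.

Lemma measurable_halfspace (dX : measure_display) (X : measurableType dX)
    (A : X -> 'M[R]_(k, d)) (z : X -> 'cV[R]_d * R) (j : nat) :
  measurable_fun setT A -> measurable_fun setT z ->
  measurable [set p | halfspace (A p) j (z p)].
Proof.
move=> mA mz; rewrite /halfspace; case: (rational_halfspace _ _ _) => [[a b] c].
apply: measurable_set_le => //; apply: measurable_funM.
  apply: measurable_compressive_classifier => //.
  - by move=> *; exact: measurable_mx_entry_comp.
  - by move=> *; apply: measurable_mx_entry_comp; exact: measurableT_comp mz.
exact: measurableT_comp mz.
Qed.

(** The bad event is defined by the countable class, hence measurable in the matrix and the sample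
    jointly, and is bounded for each fixed matrix. It does not involve [a] and [b], so these may
    afterwards be chosen from the data. *)
Lemma halfspace_uniform_deviation (L : R) : (0 < N)%N -> 0 <= L ->
  iid_sample D S -> independent2 P (training_set S) M ->
  exists B : set Omega, [/\ measurable B, (P B <= (8 * expR (- L))%:E)%E &
    forall w, ~ B w -> forall a b,
    `|\sum_(i < N) (compressive_classifier (M w) a b (S i w).1 * (S i w).2 <= 0)%R%:R
      - N%:R * true_error D (compressive_classifier (M w) a b)|
    <= 224 * Num.sqrt (N%:R * ((k + 1 + 1)%:R + L))].
Proof.
move=> N0 L0 [iS lawS] ind.
set t := 224 * _.
pose dev (j : nat) (p : 'M[R]_(k, d) * N.-tuple ('cV[R]_d * R)) : R :=
  `|\sum_(i < N) (halfspace p.1 j (tnth p.2 i))%:R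
    - N%:R * fine (D [set z | halfspace p.1 j z])|.
pose E := \bigcup_j [set p | t < dev j p].
have mD j : measurable_fun setT
    (fun p : 'M[R]_(k, d) * N.-tuple ('cV[R]_d * R) => fine (D [set z | halfspace p.1 j z])).
  pose A := [set p : 'M[R]_(k, d) * ('cV[R]_d * R) | halfspace p.1 j p.2].
  have mA : measurable A by apply: measurable_halfspace.
  apply: (measurableT_comp _ (measurable_fst
    (T1 := 'M[R]_(k, d)) (T2 := N.-tuple ('cV[R]_d * R)%type))
    (f := fun m : 'M[R]_(k, d) => fine (D [set z | halfspace m j z]))).
  apply: measurableT_comp; first exact: fine_measurable.
  rewrite (_ : (fun m => _) = D \o xsection A); first exact: measurable_fun_xsection.
  apply/funext => m /=; congr (D _).
  by apply/seteqP; split => z; rewrite /xsection/= in_setE.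
have mdev j : measurable_fun setT (dev j).
  apply: measurableT_comp => //; apply: measurable_funB; last exact: measurable_funM.
  apply: measurable_sum => i; apply: measurable_natr_bool.
  apply: measurable_halfspace => //.
  exact: (measurableT_comp (measurable_tnth i)).
have mE : measurable E.
  by apply: bigcup_measurable => j _; apply: measurable_set_lt.
pose B := [set w | E (M w, training_set S w)].
exists B; split.
- rewrite -[B]setTI; apply: (measurable_fun_pair _ measurable_training_set) => //.
- apply: (independent2_section_le (Y := training_set S)) => //.
  + exact: measurable_training_set.
  + exact: independent2_sym.
  move=> m.
  have K0 : (0 < k + 1 + 1)%N by rewrite addn1.
  have mh j : measurable [set z | halfspace m j z] by apply: measurable_halfspace.
  have mS i : measurable_fun setT (S i) by exact: measurable_funP.
  apply: le_trans (countable_class_deviation N0 mS iS lawS mh K0 (vc_le_halfspace m) L0).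
  rewrite le_eqVlt; apply/orP; left; apply/eqP; congr (P _).
  have de j w : dev j (m, training_set S w) = deviation D S (halfspace m) j w.
    by congr (`|_ - _|); apply: eq_bigr => i _; rewrite tnth_mktuple.
  by apply/seteqP; split => w [j _ /= h]; exists j => //=; rewrite ?de// -de.
move=> w nB a b.
have [n hn] := halfspace_approx d a b.
set g := compressive_classifier (M w) a b.
have hj j : dev j (M w, training_set S w) <= t.
  by rewrite leNgt; apply/negP => h; apply: nB; exists j.
have mh j : measurable [set z | halfspace (M w) j z] by apply: measurable_halfspace.
have mg : measurable [set z : 'cV[R]_d * R | g z.1 * z.2 <= 0].
  apply: measurable_set_le => //; apply: measurable_funM => //.
  apply: measurable_compressive_classifier => //.
  by move=> *; apply: measurable_mx_entry_comp.
(* Along the approximants the measures converge and the sample counts are eventually those of [g],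
   so the bound [t] survives in the limit. *)
have cD := cvg_measure_eventually_eq (fun i => mh (n i)) mg (hn (M w)).
have cf : fine (D [set z | halfspace (M w) (n i) z]) @[i --> \oo] --> true_error D g.
  by apply: fine_cvg; rewrite /true_error fineK// fin_num_measure.
set s := \sum_i _.
have c2 : `|s - N%:R * fine (D [set z | halfspace (M w) (n i) z])| @[i --> \oo]
    --> `|s - N%:R * true_error D g|.
  by apply: cvg_norm; apply: cvgB; [exact: cvg_cst|exact: cvgMr].
apply: (cvgr_to_le c2).
have hall : \forall i \near \oo, forall l : 'I_N,
    halfspace (M w) (n i) (S l w) = (g (S l w).1 * (S l w).2 <= 0).
  by apply: filter_forall => l; exact: hn.
apply: filterS hall => i hi; apply: le_trans (hj (n i)).
rewrite /dev/= le_eqVlt; apply/orP; left; apply/eqP; congr (`|_ - _|).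
by apply: eq_bigr => l _; rewrite tnth_mktuple hi.
Qed.

End sample.

(** * Flipping probabilities *)

(** The function [(1 - x) * expR (2 * x ^+ 2)] starts at 1 and has derivative
    [- expR (2 * x ^+ 2) * (1 - 2 * x) ^+ 2], so it never increases. *)
Lemma onem_le_expR_sq (R : realType) (s : R) : 0 <= s <= 1 -> 1 - s <= expR (- (2 * s ^+ 2)).
Proof.
move=> /andP[s0 s1].
pose f (x : R) := (1 - x) * expR (2 * x ^+ 2).
have df (x : R) : is_derive x 1 f (- expR (2 * x ^+ 2) * (1 - 2 * x) ^+ 2).
  have d1 : is_derive x 1 (fun x : R => 1 - x) (- 1).
    by apply: is_derive_eq; ring.
  have d2 : is_derive x 1 (fun x : R => 2 * x ^+ 2) (4 * x).
    by apply: is_derive_eq; rewrite /GRing.scale/=; ring.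
  have d3 : is_derive x 1 (fun x : R => expR (2 * x ^+ 2)) (expR (2 * x ^+ 2) * (4 * x)).
    exact: (@is_derive1_comp _ expR (fun x : R => 2 * x ^+ 2)).
  by apply: (is_derive_eq (is_deriveM d1 d3)); rewrite /GRing.scale/=; ring.
have cf : {within `[0, 1], continuous f}.
  by apply: derivable_within_continuous => x _; have [] := df x.
have : f s <= f 0.
  apply: (ler0_derive1_nincr (a := 0) (b := 1)) => // x _.
  rewrite derive1E; have [_ ->] := df x.
  by rewrite mulNr oppr_le0 mulr_ge0 ?expR_ge0 ?sqr_ge0.
rewrite /f subr0 expr0n/= mulr0 expR0 mul1r expRN => h.
by rewrite -div1r ler_pdivlMr ?expR_gt0.
Qed.

Section markov.
Variables (R : realType) (d : measure_display) (Omega : measurableType d).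
Variables (P : probability Omega R) (Y : Omega -> R) (mu : R).
Hypotheses (mY : measurable_fun setT Y) (Y01 : forall w, 0 <= Y w <= 1).
Hypothesis muE : (\int[P]_w (Y w)%:E)%E = mu%:E.

Lemma markov_strict (a : R) : 0 <= a -> (a%:E * P [set w | (a < Y w)%R] <= mu%:E)%E.
Proof.
move=> a0; set A := [set w | _].
have mA : measurable A by exact: measurable_set_lt.
rewrite -muE -[A]setIT -integral_indic// -ge0_integralZl//; last first.
  by apply/measurable_EFinP; exact: measurable_indic.
apply: ge0_le_integral => //=.
- by move=> w _; rewrite mule_ge0 ?lee_fin.
- by apply/measurable_EFinP; apply: measurable_funM => //; exact: measurable_indic.
- exact/measurable_EFinP.
- move=> w _; rewrite -EFinM lee_fin indicE; have [/set_mem/ltW|_] := boolP (w \in A).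
    by rewrite mulr1.
  by rewrite mulr0; case/andP: (Y01 w).
Qed.

(* Both terms of the minimum come from Markov's inequality: for a threshold
   mu + s <= 1 it gives mu / (mu + s) <= 1 - s <= exp (- 2 s^2). *)
Lemma upper_deviation_min (delta : R) : 0 < delta < 1 ->
  (P [set w | (mu + Num.min ((1 - delta) / delta * mu) (Num.sqrt (1 / 2 * ln (1 / delta)))
       < Y w)%R] <= delta%:E)%E.
Proof.
move=> /andP[d0 d1]; set s := Num.sqrt _.
have mu0 : 0 <= mu.
  by rewrite -lee_fin -muE; apply: integral_ge0 => w _; rewrite lee_fin; case/andP: (Y01 w).
have ln0 : 0 <= ln (1 / delta) by rewrite ln_ge0// ler_pdivlMr// mul1r ltW.
have s2 : s ^+ 2 = 1 / 2 * ln (1 / delta) by rewrite sqr_sqrtr// mulr_ge0// divr_ge0.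
have s0 : 0 <= s by exact: sqrtr_ge0.
have mlt (c : R) : measurable [set w | (c < Y w)%R] by exact: measurable_set_lt.
have bound (a p : R) : 0 < a -> mu <= p * a -> (P [set w | (a < Y w)%R] <= p%:E)%E.
  move=> a0 h; have := markov_strict (ltW a0).
  have -> : P [set w | (a < Y w)%R] = (fine (P [set w | (a < Y w)%R]))%:E.
    by rewrite fineK// fin_num_measure.
  rewrite -EFinM !lee_fin => h2.
  by rewrite -(ler_pM2l a0) (le_trans h2)// mulrC.
(* For zero mean the threshold is 0 and Markov's inequality is void; instead [Y] vanishes almost
   everywhere. *)
have [mu_0|mu_0] := eqVneq mu 0.
  rewrite mu_0 mulr0 min_l// addr0.
  have : (\int[P]_w `|(Y w)%:E|)%E = 0%E.
    rewrite -[RHS]/(0%:E) -mu_0 -muE; apply: eq_integral => w _.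
    by rewrite gee0_abs// lee_fin; case/andP: (Y01 w).
  have mEY : measurable_fun setT (fun w => (Y w)%:E) by exact/measurable_EFinP.
  move/(ae_eq_integral_abs P measurableT mEY) => [A [mA PA sA]].
  have : [set w | (0 < Y w)%R] `<=` A.
    move=> w /= Yw; apply: sA => /= h; have := h I => -[Y0].
    by rewrite Y0 ltxx in Yw.
  move/(le_measure P (mem_set (mlt 0)) (mem_set mA)) => /le_trans; apply.
  by rewrite [X in (X <= _)%E]PA lee_fin ltW.
have mupos : 0 < mu by rewrite lt_neqAle eq_sym mu_0.
rewrite /Num.min; case: ltP => _.
  (* Here the threshold is [mu / delta], for which Markov's inequality gives exactly [delta]. *)
  apply: bound; first by rewrite addr_gt0// mulr_gt0// divr_gt0// subr_gt0.
  by rewrite le_eqVlt; apply/orP; left; apply/eqP; field; rewrite gt_eqF.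
have [a1|a1] := leP 1 (mu + s).
  rewrite (_ : [set w | _] = set0) ?measure0 ?lee_fin ?ltW//.
  apply/seteqP; split => // w /= h; have /andP[_] := Y01 w.
  by rewrite leNgt (le_lt_trans a1 h).
apply: bound; first by rewrite ltr_wpDr.
have h1 : 1 - s <= delta.
  have := @onem_le_expR_sq R s; rewrite s0 (_ : s <= 1)/=; last by lra.
  move=> /(_ isT); rewrite s2 => /le_trans; apply.
  rewrite [1 / delta]div1r lnV ?posrE// (_ : - _ = ln delta) ?lnK//.
  by field.
(* The product exceeds [mu] by [s * (1 - mu - s)], nonnegative since [mu + s < 1]. *)
apply: (@le_trans _ _ ((1 - s) * (mu + s))); last by rewrite ler_pM2r// ltr_wpDr.
nra.
Qed.

End markov.

Lemma with_probability_at_least_setC2 (R : realType) (dO : measure_display)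
    (Omega : measurableType dO) (P : probability Omega R) (B1 B2 E : set Omega) (p : R) :
  measurable B1 -> measurable B2 -> (P B1 <= p%:E)%E -> (P B2 <= p%:E)%E ->
  (forall w, ~ B1 w -> ~ B2 w -> E w) -> with_probability_at_least P (1 - 2 * p) E.
Proof.
move=> mB1 mB2 P1 P2 BE; exists (~` (B1 `|` B2)).
have mB : measurable (B1 `|` B2) by exact: measurableU.
split; first exact: measurableC.
  by move=> w /not_orP[]; exact: BE.
rewrite probability_setC// EFinB leeB//.
rewrite (le_trans (measureU2 P mB1 mB2))// mulr2n mulrDl mul1r EFinD leeD//.
Qed.

Section flip.
Variables (R : realType) (k d : nat) (dO : measure_display) (Omega : measurableType dO).
Variables (P : probability Omega R) (M : {RV P >-> 'M[R]_(k, d)}) (h : 'cV[R]_d).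

(** Error event of the competitor [(m *m h, 0)], whose value at [x] is the form [h^T m^T m x] of
    [flip_prob]. *)
Definition flips (m : 'M[R]_(k, d)) (z : 'cV[R]_d * R) :=
  compressive_classifier m (m *m h) 0 z.1 * z.2 <= 0.

Lemma flip_prob_flips (z : 'cV[R]_d * R) :
  flip_prob M h (z.2 *: z.1) = fine (P [set w | flips (M w) z]).
Proof.
rewrite /flip_prob; congr (fine (P _)).
have e m : (h^T *m m^T *m m *m (z.2 *: z.1)) 0 0 =
           compressive_classifier m (m *m h) 0 z.1 * z.2.
  by rewrite -scalemxAr mxE mulrC /compressive_classifier /dotv addr0 trmx_mul mulmxA.
by apply/seteqP; split => w /=; rewrite /flips e.
Qed.

Lemma measurable_flips (dX : measure_display) (X : measurableType dX)
    (A : X -> 'M[R]_(k, d)) (z : X -> 'cV[R]_d * R) :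
  measurable_fun setT A -> measurable_fun setT z ->
  measurable [set p | flips (A p) (z p)].
Proof.
move=> mA mz.
have mA' i j : measurable_fun setT (fun p => A p i j) by exact: measurable_mx_entry_comp.
apply: measurable_set_le => //; apply: measurable_funM; last exact: measurableT_comp mz.
apply: measurable_compressive_classifier => //.
  by move=> i j; apply: measurable_mulmx.
by move=> *; apply: measurable_mx_entry_comp; exact: measurableT_comp mz.
Qed.

Let G := [set p : ('cV[R]_d * R) * Omega | flips (M p.2) p.1].

Let mG : measurable G.
Proof. by apply: measurable_flips => //; exact: measurableT_comp. Qed.

Let flip_probE z : (flip_prob M h (z.2 *: z.1))%:E = P (xsection G z).
Proof.
rewrite flip_prob_flips fineK; last by apply: fin_num_measure; exact: measurable_flips.
by congr (P _); apply/seteqP; split => w; rewrite /xsection/= in_setE.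
Qed.

Lemma measurable_flip_prob :
  measurable_fun setT (fun z : 'cV[R]_d * R => flip_prob M h (z.2 *: z.1)).
Proof.
apply/measurable_EFinP; rewrite (_ : _ \o _ = P \o xsection G).
  exact: measurable_fun_xsection.
by apply/funext => z; exact: flip_probE.
Qed.

Lemma integral_empirical_error (N : nat) (s : 'I_N -> 'cV[R]_d * R) :
  (\int[P]_w (empirical_error s (compressive_classifier (M w) (M w *m h) 0))%:E)%E =
  (empirical_flip M h s)%:E.
Proof.
have mf n : measurable [set w | flips (M w) (s n)] by exact: measurable_flips.
have mi n : measurable_fun setT (fun w => (flips (M w) (s n))%:R%:E : \bar R).
  by apply/measurable_EFinP; exact: measurable_natr_bool.
under eq_integral do rewrite /empirical_error EFinM -sumEFin.
rewrite ge0_integralZl//; last 2 first.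
- by apply: emeasurable_sum => n; exact: mi.
- by move=> w _; rewrite sume_ge0// => n _; rewrite lee_fin.
rewrite ge0_integral_sum//.
rewrite /empirical_flip EFinM -sumEFin; congr (_ * _)%E; apply: eq_bigr => n _.
rewrite flip_prob_flips fineK ?fin_num_measure//.
rewrite -[in RHS](setIT [set w | flips (M w) (s n)]) -integral_indic//.
apply: eq_integral => w _; rewrite indicE -/(flips (M w) (s n)); congr (_%:R%:E).
by case: (boolP (flips (M w) (s n))) => c; [rewrite mem_set|rewrite memNset//; exact/negP].
Qed.

Variable D : probability ('cV[R]_d * R)%type R.

Let true_errorE w :
  (true_error D (compressive_classifier (M w) (M w *m h) 0))%:E = D (ysection G w).
Proof.
rewrite /true_error fineK; last by apply: fin_num_measure; exact: measurable_flips.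
by congr (D _); apply/seteqP; split => z; rewrite /ysection/= in_setE.
Qed.

Lemma measurable_true_error :
  measurable_fun setT (fun w => true_error D (compressive_classifier (M w) (M w *m h) 0)).
Proof.
apply/measurable_EFinP; rewrite (_ : _ \o _ = D \o ysection G).
  exact: measurable_fun_ysection.
by apply/funext => w; exact: true_errorE.
Qed.

(** Fubini for the event [G]: its sections at a fixed data point have the flipping probability as
    measure, those at a fixed matrix the true error. *)
Lemma integral_true_error :
  (\int[P]_w (true_error D (compressive_classifier (M w) (M w *m h) 0))%:E)%E =
  (expected_flip M D h)%:E.
Proof.
have e : (\int[P]_w (true_error D (compressive_classifier (M w) (M w *m h) 0))%:E)%E =
         ('E_D[fun z : 'cV[R]_d * R => flip_prob M h (z.2 *: z.1)])%E.
  rewrite unlock.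
  transitivity ((D \x P)%E G); last by apply: eq_integral => z _; rewrite flip_probE.
  rewrite (product_measure_unique (m' := (D \x^ P)%E))//; last first.
    by move=> A B mA mB; rewrite /= product_measure2E.
  by apply: eq_integral => w _; rewrite true_errorE.
rewrite /expected_flip -e fineK//.
rewrite ge0_fin_numE; last by apply: integral_ge0 => w _; rewrite lee_fin fine_ge0.
apply: (@le_lt_trans _ _ (\int[P]_w (cst 1%:E w))%E).
  apply: ge0_le_integral => //.
  - by move=> w _; rewrite lee_fin fine_ge0.
  - by apply/measurable_EFinP; exact: measurable_true_error.
  - by move=> w _; rewrite true_errorE; apply: probability_le1; exact: measurable_ysection.
by rewrite integral_cst// [X in (_ * X)%E](@probability_setT _ _ _ P) mule1 ltry.
Qed.

End flip.

(** * The deviation rate in terms of delta, and the two error bounds *)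

Lemma compressive_uniform_deviation (R : realType) (k d N : nat)
    (D : probability ('cV[R]_d * R)%type R) (dO : measure_display)
    (Omega : measurableType dO) (P : probability Omega R)
    (S : 'I_N -> {RV P >-> ('cV[R]_d * R)%type}) (M : {RV P >-> 'M[R]_(k, d)}) (delta : R) :
  (0 < N)%N -> iid_sample D S -> independent2 P (training_set S) M -> 0 < delta < 1 ->
  exists B : set Omega, [/\ measurable B, (P B <= delta%:E)%E &
    forall w, ~ B w -> forall a b,
    `|empirical_error (fun n => S n w) (compressive_classifier (M w) a b)
      - true_error D (compressive_classifier (M w) a b)|
    <= 672 * Num.sqrt ((k%:R + 1 + ln (1 / delta)) / N%:R)].
Proof.
move=> N0 iS ind /andP[d0 d1].
set l := ln (1 / delta).
have l0 : 0 <= l by rewrite ln_ge0// ler_pdivlMr// mul1r ltW.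
(* The extra 3 absorbs the factor 8 in the tail bound, as [8 * expR (- 3) <= 1]. *)
have L0 : 0 <= l + 3 by rewrite addr_ge0.
have [B [mB PB hB]] := halfspace_uniform_deviation N0 L0 iS ind.
have N0' : (0 : R) < N%:R by rewrite ltr0n.
exists B; split => //.
  apply: (le_trans PB); rewrite lee_fin.
  have -> : expR (- (l + 3)) = delta * expR (- 3).
    rewrite opprD expRD; congr (_ * _).
    by rewrite /l div1r lnV ?posrE// opprK lnK.
  rewrite mulrCA ger_pMr// expRN ler_pdivrMr ?expR_gt0// mul1r.
  have e2 : 2 <= expR 1 :> R by have := expR_ge1Dx (1 : R); lra.
  have -> : expR 3 = expR 1 ^+ 3 :> R by rewrite -expRM_natl mulr1.
  apply: (@le_trans _ _ (2 ^+ 3)); first by rewrite !exprS expr0; lra.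
  by apply: lerXn2r; rewrite ?nnegrE ?expR_ge0.
move=> w nB a b.
rewrite -(ler_pM2l N0') -[X in X * `|_|](gtr0_norm N0') -normrM mulrBr.
rewrite /empirical_error mulVKf ?gt_eqF//; apply: (le_trans (hB w nB a b)).
set q := k%:R + 1 + l.
have q0 : 0 <= q by rewrite !addr_ge0.
(* Since [k + 2 + (l + 3) <= 9 * (k + 1 + l)], the constant becomes [672 = 3 * 224]. *)
have -> : N%:R * (672 * Num.sqrt (q / N%:R)) = 224 * Num.sqrt (N%:R * (9 * q)).
  have -> : N%:R * (9 * q) = (3 * N%:R) ^+ 2 * (q / N%:R) by field; rewrite gt_eqF.
  rewrite [in RHS]sqrtrM ?sqr_ge0// sqrtr_sqr ger0_norm; last by rewrite mulr_ge0// ltW.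
  ring.
rewrite ler_pM2l// ler_wsqrtr// ler_pM2l//.
have : 0 <= k%:R :> R by [].
by rewrite /q !natrD; lra.
Qed.

Lemma empirical_error_itv (R : realType) (d N : nat) (s : 'I_N -> 'cV[R]_d * R)
    (g : 'cV[R]_d -> R) : (0 < N)%N -> 0 <= empirical_error s g <= 1.
Proof.
move=> N0; have N0' : (0 : R) < N%:R by rewrite ltr0n.
rewrite /empirical_error mulr_ge0 ?invr_ge0 ?sumr_ge0//=.
rewrite mulrC ler_pdivrMr// mul1r -[N in leRHS]card_ord -sumr_const.
by apply: ler_sum => n _; rewrite lern1 leq_b1.
Qed.

Theorem theorem2p3 (R : realType) :
  exists c : R, 0 < c /\
  forall (k d N : nat) (hk : (0 < k)%N) (hkd : (k <= d)%N) (hN : (0 < N)%N)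
    (* D is a distribution on calX x {-1, 1} *)
    (calX : set 'cV[R]_d) (mcalX : measurable calX)
    (D : probability ('cV[R]_d * R)%type R)
    (hD : D (calX `*` [set -1; 1]) = 1%E)
    (dO : measure_display) (Omega : measurableType dO)
    (P : probability Omega R)
    (S : 'I_N -> {RV P >-> ('cV[R]_d * R)%type})
    (hS : iid_sample D S)
    (sigma : R) (hsigma : 0 < sigma)
    (M : {RV P >-> 'M[R]_(k, d)})
    (hM : gaussian_matrix sigma M)
    (hind : independent2 P (training_set S) M)
    (hhat : Omega -> 'cV[R]_k) (b : Omega -> R)
    (hERM : forall w, is_compressive_ERM (M w) (fun n => S n w) (hhat w) (b w)),
    (forall (h : 'cV[R]_d) (delta : R), 0 < delta < 1 ->
      with_probability_at_least P (1 - 2 * delta)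
        [set w |
          true_error D (compressive_classifier (M w) (hhat w) (b w)) <=
          empirical_flip M h (fun n => S n w)
          + c * Num.sqrt ((k%:R + 1 + ln (1 / delta)) / N%:R)
          + Num.min
              ((1 - delta) / delta * empirical_flip M h (fun n => S n w))
              (Num.sqrt (1 / 2 * ln (1 / delta)))])
    /\
    (forall (hstar : 'cV[R]_d), is_optimal_homogeneous D hstar ->
      forall (delta : R), 0 < delta < 1 ->
      with_probability_at_least P (1 - 2 * delta)
        [set w |
          true_error D (compressive_classifier (M w) (hhat w) (b w)) <=
          expected_flip M D hstar
          + 2 * c * Num.sqrt ((k%:R + 1 + ln (1 / delta)) / N%:R)
          + Num.min
              ((1 - delta) / delta * expected_flip M D hstar)
              (Num.sqrt (1 / 2 * ln (1 / delta)))]).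
Proof.
exists 672; split; first by [].
move=> k d N hk hkd hN calX mcalX D hD dO Omega P S hS sigma hsigma M hM hind hhat b hERM.
have tsE w : tnth (training_set S w) = (fun n => S n w).
  by apply/funext => n; rewrite tnth_mktuple.
(* Here [em] and [tr] are the empirical and true errors of the minimizer, [emh] and [trh] those of
   the competitor. Comparison through [trh] uses the uniform deviation twice, whence the factor 2 in
   [combine2]. *)
have combine1 (tr em emh ef c m : R) :
    emh <= ef + m -> em <= emh -> `|em - tr| <= c -> tr <= ef + c + m.
  by rewrite ler_norml => h1 h2 /andP[h3 h4]; lra.
have combine2 (tr em emh trh ef c m : R) :
    trh <= ef + m -> em <= emh -> `|em - tr| <= c -> `|emh - trh| <= c ->
    tr <= ef + 2 * c + m.
  by rewrite !ler_norml => h1 h2 /andP[h3 h4] /andP[h5 h6]; lra.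
have mM : measurable_fun setT M by exact: measurable_funP.
split=> [h|h hopt] delta delta01;
    have [B [mB PB devB]] := compressive_uniform_deviation hN hS hind delta01.
(* The mean [mu] depends on the sample here, so the bad event is a set of pairs, bounded over the
   draw of the matrix for each fixed sample. *)
- pose mu (s : N.-tuple ('cV[R]_d * R)) : R := empirical_flip M h (tnth s).
  pose e (p : N.-tuple ('cV[R]_d * R) * 'M[R]_(k, d)) : R :=
    empirical_error (tnth p.1) (compressive_classifier p.2 (p.2 *m h) 0).
  pose E := [set p | mu p.1 + Num.min ((1 - delta) / delta * mu p.1)
    (Num.sqrt (1 / 2 * ln (1 / delta))) < e p].
  have mmu : measurable_fun setT (fun p : N.-tuple ('cV[R]_d * R) * 'M[R]_(k, d) => mu p.1).
    apply: (measurableT_comp _ measurable_fst).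
    apply: measurable_funM => //; apply: measurable_sum => n.
    exact: (measurableT_comp (measurable_flip_prob M h) (measurable_tnth n)).
  have me : measurable_fun setT e.
    apply: measurable_funM => //; apply: measurable_sum => n.
    apply: measurable_natr_bool; apply: measurable_flips => //.
    exact: (measurableT_comp (measurable_tnth n)).
  have mE : measurable E.
    apply: measurable_set_lt => //; apply: measurable_funD => //.
    by apply: measurable_minr => //; exact: measurable_funM.
  have PE : (P [set w | E (training_set S w, M w)] <= delta%:E)%E.
    apply: independent2_section_le => //.
    + exact: measurable_training_set.
    + by case/andP: delta01 => /ltW.
    move=> s.
    have mes : measurable_fun setT (fun w => e (s, M w)).
      exact: (measurableT_comp (measurableT_comp me (measurable_pair1 s)) mM).
    exact: (upper_deviation_min mes (fun w => empirical_error_itv _ _ hN)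
      (integral_empirical_error M h (tnth s)) delta01).
  apply: (with_probability_at_least_setC2 mB _ PB PE).
    rewrite -[X in measurable X]setTI.
    exact: (measurable_fun_pair (measurable_training_set S) mM).
  move=> w nB /negP; rewrite -leNgt /E /= /e /mu /= tsE => nE.
  exact: combine1 nE (hERM w (M w *m h) 0) (devB w nB _ _).
(* The competitor's true error depends on the matrix alone and its mean is a constant, so no
   conditioning on the sample is required. *)
- pose mu := expected_flip M D h.
  pose Y w := true_error D (compressive_classifier (M w) (M w *m h) 0).
  have mY : measurable_fun setT Y by exact: measurable_true_error.
  have Y01 w : 0 <= Y w <= 1.
    rewrite /Y /true_error fine_ge0//=.
    rewrite -lee_fin fineK ?fin_num_measure//; last exact: measurable_flips.
    by apply: probability_le1; exact: measurable_flips.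
  have PE := upper_deviation_min mY Y01 (integral_true_error M h D) delta01.
  apply: (with_probability_at_least_setC2 mB _ PB PE).
  + exact: measurable_set_lt.
  + move=> w nB /negP; rewrite -leNgt => nE.
    rewrite /= -[2 * 672 * _]mulrA.
    exact: combine2 nE (hERM w (M w *m h) 0) (devB w nB _ _) (devB w nB _ _).
Qed.
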